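(* Let $q$ be an odd prime power. Then: (1) if $q^2-q+1$ is prime, then $PSU_4(q)$ has a minimal logarithmic signature; (2) if $q > 5$ and $q+1 = 2p$ for some prime $p$, then $PSU_4(q)$ has a minimal logarithmic signature.
   Context: All groups are finite. For a finite group $G$, a logarithmic signature of $G$ is an ordered tuple $[A_1,\ldots,A_s]$ of subsets $A_i \subseteq G$ such that every element $g \in G$ can be written uniquely as a product $g = a_1a_2\cdots a_s$ with $a_i \in A_i$ for each $i$. Its length is $\sum_{i=1}^s |A_i|$. If $|G| = p_1^{\beta_1}\cdots p_k^{\beta_k}$ with $p_1,\ldots,p_k$ distinct primes and $\beta_j \ge 1$, every logarithmic signature has length at least $\sum_{j=1}^k \beta_j p_j$, and a logarithmic signature is called minimal (an MLS) if its length equals $\sum_{j=1}^k \beta_j p_j$. $PSU_4(q)$ is the projective special unitary group $SU_4(q)/Z(SU_4(q))$, where $SU_4(q)$ is the special unitary group of dimension $4$ over $GF(q^2)$. *)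

(* Defs.v *)
From HB Require Import structures.
From mathcomp Require Import all_boot all_order all_algebra all_fingroup all_solvable.
Set Implicit Arguments. Unset Strict Implicit. Unset Printing Implicit Defensive.
Import GRing.Theory.
Local Open Scope group_scope.

Fixpoint nfact (gT : finGroupType) (s : seq {set gT}) (g : gT) : nat :=
  match s with
  | [::] => (g == 1)
  | A :: s' => \sum_(a in A) nfact s' (a^-1 * g)
  end.

Definition log_sig (gT : finGroupType) (G : {set gT}) (s : seq {set gT}) : Prop :=
  (forall A, A \in s -> A \subset G) /\ (forall g, g \in G -> nfact s g = 1%N).

Definition ls_length (gT : finGroupType) (s : seq {set gT}) : nat :=
  \sum_(A <- s) #|A|.

Definition mls_bound (gT : finGroupType) (G : {set gT}) : nat :=
  \sum_(p <- primes #|G|) (logn p #|G| * p).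

Definition has_MLS (gT : finGroupType) (G : {set gT}) : Prop :=
  exists s : seq {set gT}, log_sig G s /\ ls_length s = mls_bound G.

(* F is a finite field of order q^2; the field involution is x |-> x^q. *)
Definition SU4_set (F : finFieldType) (q : nat) : {set {'GL_4[F]}} :=
  [set u : {'GL_4[F]} |
     ((\det (GLval u) == 1) &&
      (GLval u *m (map_mx (fun x : F => x ^+ q) (GLval u))^T == 1%:M))%R].

(* SU_4(q) as a group (SU4_set is a subgroup when #|F| = q^2; the
   generated group <<_>> is used only to get the {group _} structure). *)
Definition SU4 (F : finFieldType) (q : nat) : {group {'GL_4[F]}} :=
  <<SU4_set F q>>%G.

Definition PSU4 (F : finFieldType) (q : nat) :=
  (SU4 F q / 'Z(SU4 F q))%G.

(* Main.v *)
From HB Require Import structures.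
From mathcomp Require Import all_boot all_order all_algebra all_fingroup all_solvable all_field.
From mathcomp Require Import ring zify.
Require Import Defs.

(* A product of subsets A_1 ... A_s of G that covers G, with |A_1| ... |A_s|
   = |G| and every |A_i| prime, is a minimal logarithmic signature, and such
   products compose along a chain of subgroups: it suffices to cover a
   transitive G-set by a product of sets of prime size applied to a base point,
   and to go on with the stabiliser.  Solvable groups are covered trivially.
   SU_4(q) acts on the (q + 1)(q^3 + 1) totally isotropic lines, on which
   already the stabiliser GU_3(q) of a nonisotropic point is transitive: it acts
   on the q^3 + 1 isotropic points of its 3-space, and q + 1 lines pass through
   each of them, permuted regularly by a cyclic group.  A line stabiliser acts
   on the q^2 + 1 points of the line through SL_2(q^2), and a flag stabiliser is
   solvable.
   The arithmetic hypotheses enter only for the q^3 + 1 isotropic points.  The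
   powers a^j, 0 < j < n, of an element a of GU_3(q) move every point, so q^3 + 1 =
   2 l n for a set of 2 l points meeting all their orbits; as GU_3(q) is
   2-transitive, these points are the images under l elements of one pair of
   points.  This takes care of a factor 2 l with l prime.  In case (1), a is
   diagonal, n = (q + 1) / 2 and l = q^2 - q + 1; in case (2), a is a Singer
   cycle, n = q^2 - q + 1 and l = (q + 1) / 2. *)

Set Implicit Arguments. Unset Strict Implicit. Unset Printing Implicit Defensive.
Import GRing.Theory.
Local Open Scope group_scope.

(** * Products of sets of prime size *)

(** Any set of prime size is admissible as a block, however unstructured, whereas a composite number
    of cosets must be covered by a genuine product. Powers 1, a, ..., a^(n-1) always are such a
    product, whatever n. This dictates the treatment of the q^3 + 1 isotropic points: powers of one
    element account for the factor n, and the remaining 2 l points have no structure to exploit.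
    They are still manageable if l is prime, since any l elements may form a block; 2-transitivity
    serves to absorb the extra factor 2 into the single block {1, s}. Uniqueness of factorisations
    is never checked directly. A cover by sets whose sizes are bounded by the right numbers leaves
    no room for repetitions, so only covers and orders have to be established along the chain.
    Vectors are rows and groups act on the right, so cosets are H g and the blocks of the smaller
    group stand to the left. The quotient by the centre leaves indices unchanged because the chain
    is cut at the flag stabiliser, which contains the centre. *)

(* In a block [(A, p)] the prime [p] is only an upper bound for [#|A|]: the
   cardinality condition of [tiling] then forces equality. *)
Definition prime_blocks (gT : finGroupType) (G : {set gT})
    (s : seq ({set gT} * nat)) :=
  forall x, x \in s -> [/\ x.1 \subset G, #|x.1| <= x.2 & prime x.2].

Definition tiling (gT : finGroupType) (G H : {set gT})
    (s : seq ({set gT} * nat)) :=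
  [/\ prime_blocks G s, G \subset H * \prod_(x <- s) x.1
    & (#|H| * (\prod_(x <- s) x.2)%N = #|G|)%N].

Section Tiling.

Variable gT : finGroupType.
Implicit Types (G H K N P : {group gT}) (s t : seq ({set gT} * nat)).

Lemma prime_blocks_cat (G : {set gT}) s t :
  prime_blocks G s -> prime_blocks G t -> prime_blocks G (s ++ t).
Proof. by move=> Bs Bt x; rewrite mem_cat => /orP[/Bs|/Bt]. Qed.

Lemma prime_blocksS (G H : {set gT}) s :
  G \subset H -> prime_blocks G s -> prime_blocks H s.
Proof. by move=> sGH Bs x /Bs[sG ? ?]; split=> //; apply: subset_trans sGH. Qed.

Lemma tiling_trans G H K s t :
  H \subset G -> tiling G H s -> tiling H K t -> tiling G K (t ++ s).
Proof.
move=> sHG [Bs covG cardG] [Bt covH cardH]; split.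
- by apply: prime_blocks_cat => //; apply: prime_blocksS Bt.
- by rewrite big_cat mulgA (subset_trans covG) ?mulSg.
- by rewrite big_cat /= mulnA cardH.
Qed.

(** The case of a subgroup [N] transitive on the cosets of [P]: as [G = P N], the cosets of
    [N :&: P] in [N] correspond to those of [P] in [G], and the blocks found inside [N] serve for
    [G]. *)
Lemma tiling_setI G N P s :
  P \subset G -> G \subset P * N -> N \subset G ->
  tiling N (N :&: P) s -> tiling G P s.
Proof.
move=> sPG sGPN sNG [Bs covN cardN].
have defG : P * N = G :> {set gT}.
  by apply/eqP; rewrite eqEsubset sGPN andbT mul_subG.
split; first exact: prime_blocksS Bs.
- apply: subset_trans sGPN _; apply: subset_trans (mulgS _ covN) _.
  by rewrite mulgA mulGSid ?subsetIr.
- have nzI: 0 < #|N :&: P| by exact: cardG_gt0.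
  have := mul_cardG P N; rewrite defG (setIC P) => cardPN.
  by apply/eqP; rewrite -(eqn_pmul2r nzI) -cardPN -cardN mulnAC mulnA.
Qed.

Lemma leq_mul_tight (a b c d : nat) :
  0 < c -> 0 < d -> a <= c -> c * d <= a * b -> b <= d -> a = c /\ b = d.
Proof.
move=> c0 d0 ac cdab bd.
have E: (a * b)%N = (c * d)%N by apply/eqP; rewrite eqn_leq cdab leq_mul.
have b0: 0 < b by rewrite lt0n; apply: contraTneq cdab => ->; rewrite muln0 -ltnNge muln_gt0 c0.
have: a = c.
  apply/eqP; rewrite eqn_leq ac -(leq_pmul2r d0).
  by rewrite (leq_trans cdab) // leq_mul.
by move=> Ea; split=> //; apply/eqP; rewrite -(eqn_pmul2l c0) -E Ea.
Qed.

Lemma card_set_prod s : #|\prod_(x <- s) x.1| <= \prod_(x <- s) #|x.1|.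
Proof.
elim: s => [|x s IHs]; first by rewrite !big_nil cards1.
rewrite !big_cons; apply: leq_trans (leq_mul (leqnn _) IHs).
rewrite -[mul _ _]/(x.1 * _)%g [X in X <= _](eq_card (B := [set u.1 * u.2 | u in setX x.1 (\prod_(y <- s) y.1)])).
  by rewrite (leq_trans (leq_imset_card _ _)) // cardsX.
move=> g; apply/mulsgP/imsetP => [[a b Aa Bb ->]|[[a b]]].
  by exists (a, b); rewrite ?inE ?Aa.
by rewrite inE => /andP[/= Aa Bb] ->; exists a b.
Qed.

Lemma prime_blocks_prodn G s : prime_blocks G s ->
  (0 < \prod_(x <- s) x.2) && (\prod_(x <- s) #|x.1| <= \prod_(x <- s) x.2).
Proof.
elim: s => [|x s IHs] Bs; first by rewrite !big_nil.
have [_ Ax px] := Bs x (mem_head _ _).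
have /andP[p0 le] : (0 < \prod_(y <- s) y.2) && (\prod_(y <- s) #|y.1| <= \prod_(y <- s) y.2).
  by apply: IHs => y ys; apply: Bs; rewrite inE ys orbT.
by rewrite !big_cons muln_gt0 prime_gt0 //= p0 leq_mul.
Qed.

Lemma prime_blocks_tight G s : prime_blocks G s ->
  \prod_(x <- s) x.2 <= (\prod_(x <- s) #|x.1|)%N ->
  forall x, x \in s -> #|x.1| = x.2.
Proof.
elim: s => [|x s IHs] Bs //; rewrite !big_cons => le y.
have Bs': prime_blocks G s by move=> z zs; apply: Bs; rewrite inE zs orbT.
have [_ Ax px] := Bs x (mem_head _ _).
have /andP[p0 le'] := prime_blocks_prodn Bs'.
have [E1 E2] := leq_mul_tight (prime_gt0 px) p0 Ax le le'.
by rewrite inE => /predU1P[->|] //; apply: IHs => //; rewrite E2.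
Qed.

(** Counts all tuples of block elements by their product; translation by an element of the first
    block permutes [G]. *)
Lemma nfact_sum G s : prime_blocks G s ->
  \sum_(g in G) nfact (map fst s) g = (\prod_(x <- s) #|x.1|)%N.
Proof.
elim: s => [|x s IHs] Bs.
  rewrite big_nil /= (bigD1 1) //= eqxx big1 ?addn0 // => g /andP[_ /negbTE->] //.
have Bs': prime_blocks G s by move=> z zs; apply: Bs; rewrite inE zs orbT.
have [sA _ _] := Bs x (mem_head _ _).
rewrite big_cons -(IHs Bs') /= exchange_big /= -sum_nat_const.
apply: eq_bigr => a Aa; have Ga := subsetP sA a Aa.
rewrite (reindex_inj (mulgI a)) /=.
by apply: eq_big => g; rewrite ?groupMl // mulKg.
Qed.

Lemma nfact_gt0 s g : g \in \prod_(x <- s) x.1 -> 0 < nfact (map fst s) g.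
Proof.
elim: s g => [|x s IHs] g; rewrite ?big_nil ?big_cons /=.
  by move/set1P->; rewrite eqxx.
case/mulsgP=> a b Aa Bb ->; rewrite (bigD1 a) //= mulKg.
by rewrite addn_gt0 IHs.
Qed.

Lemma mls_bound_prod (s : seq nat) : all prime s ->
  (\sum_(p <- primes (\prod_(x <- s) x)) logn p (\prod_(x <- s) x)%N * p
    = \sum_(x <- s) x)%N.
Proof.
(* The range of numbers below [N] replaces the prime divisors of the product, so that the index set
   stays fixed during the induction on [s]. *)
move=> ps; pose N := (\prod_(x <- s) x).+1.
have n0: 0 < \prod_(x <- s) x.
  rewrite big_seq; elim/big_ind: _ => // [x y x0 y0|x xs]; first by rewrite muln_gt0 x0.
  by rewrite prime_gt0 // (allP ps).
have aux (n M : nat) : 0 < n < M ->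
  (\sum_(p <- primes n) logn p n * p = \sum_(p <- iota 0 M) logn p n * p)%N.
  move=> /andP[npos nM]; rewrite [RHS](bigID (mem (primes n))) /=.
  rewrite [X in (_ + X)%N]big1 ?addn0; last first.
    by move=> p; rewrite -logn_gt0 lt0n negbK => /eqP->.
  rewrite -[in RHS]big_filter; apply: perm_big; apply: uniq_perm.
  - exact: primes_uniq.
  - by rewrite filter_uniq ?iota_uniq.
  - move=> p; rewrite mem_filter mem_iota /= add0n andb_idr //.
    by rewrite mem_primes => /and3P[_ _ /(dvdn_leq npos)/leq_ltn_trans->].
rewrite (aux _ N); last by rewrite n0 /=.
have sN : all (fun x => x < N) s.
  apply/allP=> x xs; rewrite ltnS dvdn_leq //.
  by rewrite (perm_big _ (perm_to_rem xs)) big_cons dvdn_mulr.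
move: N sN => M sM; rewrite {aux n0}; elim: s ps sM => [_ _|x s IHs].
  by rewrite !big_nil big1 // => p _; rewrite logn1.
rewrite /= => /andP[px ps] /andP[xM sM]; rewrite !big_cons.
have n0: 0 < \prod_(x <- s) x.
  rewrite big_seq; elim/big_ind: _ => // [y z y0 z0|y ys]; first by rewrite muln_gt0 y0.
  by rewrite prime_gt0 // (allP ps).
under eq_bigr do rewrite lognM ?(prime_gt0 px) // mulnDl.
rewrite big_split /= (IHs ps sM); congr (_ + _)%N.
rewrite (bigD1_seq x) ?iota_uniq ?mem_iota //= logn_prime // eqxx mul1n.
by rewrite big1 ?addn0 // => p npx; rewrite logn_prime //; case: eqP npx => // ->; rewrite eqxx.
Qed.

(** Every element of [G] has at least one factorisation because the sets cover, and the numbers of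
    factorisations add up to [#|G|]; hence each of them is 1. *)
Lemma tiling1_MLS G s : tiling G 1 s -> has_MLS G.
Proof.
case=> Bs; rewrite cards1 mul1n mul1g => covG cardG.
have le: \prod_(x <- s) x.2 <= \prod_(x <- s) #|x.1|.
  by rewrite cardG (leq_trans (subset_leq_card covG)) ?card_set_prod.
have tight := prime_blocks_tight Bs le.
have Ecard: (\prod_(x <- s) #|x.1| = #|G|)%N by rewrite -cardG; apply: eq_big_seq.
exists (map fst s); split; first split.
- by move=> A /mapP[x /Bs[sx _ _] ->].
- have pos g : g \in G -> 0 < nfact (map fst s) g.
    by move=> Gg; apply: nfact_gt0; apply: (subsetP covG).
  have := nfact_sum Bs; rewrite Ecard -sum1_card => /eqP; rewrite eq_sym.
  move=> Esum g Gg.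
  have : forall g : gT, g \in G -> 1 <= nfact (map fst s) g ?= iff (1%N == nfact (map fst s) g).
    by move=> h Gh; split=> //; apply: pos.
  move/(@leqif_sum gT (mem G)) => -[_]; rewrite Esum => /esym/forall_inP/(_ g Gg)/eqP.
  by [].
- rewrite /ls_length /mls_bound big_map -cardG.
  have := @mls_bound_prod (map snd s); rewrite !big_map => ->.
    by apply: eq_big_seq.
  by apply/allP=> _ /mapP[x /Bs[_ _ px] ->].
Qed.

(** Mixed radix: for a prime divisor [p] of [n] and j = r + p t with r < p, the first block supplies
    a^r, and induction for [a ^+ p] and n / p supplies the rest. *)
Lemma powers_blocks (a : gT) n : 0 < n ->
  exists s, [/\ prime_blocks <[a]> s, (\prod_(x <- s) x.2 = n)%N
    & forall j, j < n -> a ^+ j \in \prod_(x <- s) x.1].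
Proof.
elim/ltn_ind: n a => n IHn a n0.
have [n1|n_neq1] := eqVneq n 1%N.
  exists [::]; split=> //; first by rewrite big_nil n1.
  by move=> j; rewrite n1 ltnS leqn0 => /eqP->; rewrite big_nil set11.
have n1: 1 < n by rewrite ltn_neqAle eq_sym n_neq1.
pose p := pdiv n; have pp : prime p by apply: pdiv_prime.
have pn : p %| n by apply: pdiv_dvd.
have nE: (n = p * (n %/ p))%N by rewrite mulnC divnK.
have [||s [Bs Es Cs]] := IHn (n %/ p) _ (a ^+ p).
- by rewrite ltn_Pdiv // prime_gt1.
- by rewrite divn_gt0 ?prime_gt0 // dvdn_leq.
exists (([set a ^+ val i | i : 'I_p], p) :: s); split.
- move=> x; rewrite inE => /predU1P[->|xs] /=.
    split=> //; last by rewrite (leq_trans (leq_imset_card _ _)) // cardT size_enum_ord.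
    by apply/subsetP=> _ /imsetP[i _ ->]; apply: mem_cycle.
  have [sx ? ?] := Bs x xs; split=> //; apply: subset_trans sx _.
  by rewrite cycle_subG mem_cycle.
- by rewrite big_cons Es -nE.
- move=> j jn; rewrite big_cons; apply/mulsgP.
  exists (a ^+ (j %% p)) ((a ^+ p) ^+ (j %/ p)).
  + have jp: j %% p < p by rewrite ltn_mod prime_gt0.
    by apply/imsetP; exists (Ordinal jp).
  + by apply: Cs; rewrite ltn_divLR ?prime_gt0 // mulnC -nE.
  + by rewrite -expgM -expgD mulnC addnC -divn_eq.
Qed.

(** The first condition makes the n cosets [H :* a ^+ j] distinct, the second makes them exhaust
    [G]; together they pin the index to n. *)
Lemma tiling_powers G H (a : gT) n :
  0 < n -> a \in G -> H \subset G ->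
  (forall j, 0 < j < n -> a ^+ j \notin H) ->
  (forall g, g \in G -> exists2 j, j < n & g * a ^- j \in H) ->
  exists s, tiling G H s.
Proof.
move=> n0 Ga sHG free cov; have [s [Bs Es Cs]] := powers_blocks a n0.
have cov': G \subset H * \prod_(x <- s) x.1.
  apply/subsetP=> g /cov[j jn Hg]; apply/mulsgP.
  by exists (g * a ^- j) (a ^+ j); rewrite ?Cs // mulgKV.
have Bs' : prime_blocks G s by apply: prime_blocksS Bs; rewrite cycle_subG.
exists s; split=> //; apply/eqP; rewrite eqn_leq; apply/andP; split.
  rewrite -(Lagrange sHG) leq_mul2l; apply/orP; right.
  rewrite Es -[n]card_ord -(card_imset (f := fun i : 'I_n => H :* a ^+ i)).
    apply: subset_leq_card; apply/subsetP=> _ /imsetP[i _ ->].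
    by apply/rcosetsP; exists (a ^+ i); rewrite ?groupX.
  have aux (i j : 'I_n) : i < j -> H :* a ^+ i != H :* a ^+ j.
    move=> ij; apply/eqP=> E; have : a ^+ j \in H :* a ^+ i by rewrite E rcoset_refl.
    rewrite mem_rcoset -{1}(subnK (ltnW ij)) expgD mulgK => Hj.
    by have := free (j - i)%N; rewrite Hj subn_gt0 ij (leq_ltn_trans (leq_subr _ _)) // => /(_ isT).
  move=> i j E; apply: val_inj; case: (ltngtP i j) => // [/aux|/aux]; by rewrite E eqxx.
have /andP[_ le] := prime_blocks_prodn Bs'.
apply: leq_trans (subset_leq_card cov') _; apply: leq_trans (leq_mul (leqnn _) le).
by have := card_set_prod ((H : {set gT}, 0%N) :: s); rewrite !big_cons.
Qed.

(** Induction through a subgroup [M] that is maximal normal modulo [K]: its index is prime, so a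
    transversal of [M] is a single block. *)
Lemma tiling_sol_quotient G K : K <| G -> solvable (G / K) -> exists s, tiling G K s.
Proof.
move: {2}#|G| (leqnn #|G|) => n; elim: n G => [|n IHn] G; first by rewrite leqNgt cardG_gt0.
move=> leG nKG solGK; have sKG := normal_sub nKG.
have [E|neq] := eqVneq (K : {set gT}) G.
  by exists [::]; split; rewrite ?big_nil ?mulg1 ?muln1 ?E.
have ntQ : G / K :!=: 1 by rewrite -subG1 quotient_sub1 ?normal_norm // eqEsubset sKG in neq *.
have [N maxN] := ex_maxnormal_ntrivg ntQ.
have prN := index_maxnormal_sol_prime solGK maxN.
pose M := (coset K @*^-1 N)%G.
have defMK : M / K = N by apply: cosetpreK.
have sKM : K \subset M by apply: sub_cosetpre.
have nMG : M <| G by rewrite -(quotientGK nKG) cosetpre_normal (maxnormal_normal maxN).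
have sMG := normal_sub nMG; have nKM : K <| M by apply: normalS nKG.
have ixM : prime #|G : M|.
  have <- : #|G / K : M / K| = #|G : M|.
    apply: index_quotient_eq; first by rewrite subIset // sKM orbT.
      by [].
    exact: normal_norm.
  by rewrite defMK.
have [x Gx nMx] : exists2 x, x \in G & x \notin M.
  by apply/subsetPn; apply: contraL ixM => sGM; rewrite (eqP (_ : #|G : M| == 1%N)) // indexg_eq1.
have [s ts] : exists s, tiling M K s.
  apply: IHn => //; last by rewrite (solvableS _ solGK) // quotientS.
  rewrite -ltnS (leq_trans _ leG) // proper_card // properEneq sMG andbT.
  by apply: contraNneq nMx => ->.
have [t tt] : exists t, tiling G M t.
  pose X := [set repr y | y in rcosets M G].
  exists [:: (X, #|G : M|)]; split.
  - move=> y; rewrite inE => /eqP-> /=; split=> //; last exact: leq_imset_card.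
    apply/subsetP=> _ /imsetP[_ /rcosetsP[g Gg ->] ->].
    by case: repr_rcosetP => m Mm; rewrite groupM // (subsetP sMG).
  - rewrite big_seq1; apply/subsetP=> g Gg; apply/mulsgP.
    exists (g * (repr (M :* g))^-1) (repr (M :* g)); last by rewrite mulgKV.
      by case: repr_rcosetP => m Mm; rewrite invMg mulKVg groupV.
    by apply: imset_f; apply/rcosetsP; exists g.
  - by rewrite big_seq1 Lagrange.
by exists (s ++ t); apply: tiling_trans tt ts.
Qed.

Lemma tiling_sol G : solvable G -> exists s, tiling G 1 s.
Proof.
by move=> solG; apply: (@tiling_sol_quotient G 1%G (normal1 G)); apply: quotient_sol.
Qed.

(** Orbit-stabiliser without an action structure: [f g] stands for a base point moved by [g]. *)
Lemma index_orbit (T : finType) (f : gT -> T) G H :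
  H \subset G ->
  {in G &, forall g h, (f g == f h) = (g * h^-1 \in H)} -> #|f @: G| = #|G : H|.
Proof.
move=> sHG fE.
have -> : f @: G = (fun X => f (repr X)) @: rcosets H G.
  apply/setP=> y; apply/imsetP/imsetP => [[g Gg ->]|[_ /rcosetsP[g Gg ->] ->]].
    exists (H :* g); first by apply/rcosetsP; exists g.
    apply/eqP; case: repr_rcosetP => h Hh; have Gh := subsetP sHG h Hh.
    have Ghg : h * g \in G by rewrite groupM.
    by rewrite fE // invMg mulKVg groupV.
  by exists (repr (H :* g)) => //; case: repr_rcosetP => h Hh; rewrite groupM // (subsetP sHG).
rewrite card_in_imset // => _ _ /rcosetsP[g Gg ->] /rcosetsP[h Gh ->] /eqP.
have rG x : x \in G -> repr (H :* x) \in G.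
  by move=> Gx; case: repr_rcosetP => y Hy; rewrite groupM // (subsetP sHG).
rewrite fE ?rG // => E0; have := rcoset_eqP (_ : repr (H :* g) \in H :* repr (H :* h)); rewrite mem_rcoset => /(_ E0) E.
have rr x : H :* repr (H :* x) = H :* x by apply: rcoset_repr.
by rewrite -(rr g) -(rr h).
Qed.

End Tiling.

(** As [H] contains the kernel on [G], both orders shrink by the same factor. Images of blocks might
    be smaller a priori, which the upper bounds in [prime_blocks] tolerate. *)
Lemma tiling_morphim (aT rT : finGroupType) (D : {group aT})
    (f : {morphism D >-> rT}) (G H : {group aT}) s :
  G \subset D -> H \subset G -> 'ker_G f \subset H -> tiling G H s ->
  tiling (f @* G) (f @* H) [seq (f @* x.1, x.2) | x <- s].
Proof.
move=> sGD sHG sKH [Bs covG cardG].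
have sHD := subset_trans sHG sGD.
have prodE : forall t, prime_blocks G t ->
  f @* (\prod_(x <- t) x.1) = \prod_(x <- [seq (f @* x.1, x.2) | x <- t]) x.1.
  elim=> [|x t IHt] Bt; first by rewrite !big_nil morphim1.
  have [sx _ _] := Bt x (mem_head _ _).
  by rewrite /= !big_cons -IHt ?morphimMl ?(subset_trans sx) // => y yt; apply: Bt; rewrite inE yt orbT.
split.
- move=> _ /mapP[x /Bs[sx lx px] ->]; split=> //=; first exact: morphimS.
  exact: leq_trans (leq_morphim _ _) lx.
- by rewrite -prodE // -morphimMl // morphimS.
- have cardE (K : {group aT}) : K \subset G -> 'ker_G f \subset K ->
    (#|f @* K| * #|'ker_G f| = #|K|)%N.
    move=> sKG kK; rewrite card_morphim (setIidPr (subset_trans sKG sGD)).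
    rewrite -[RHS](LagrangeI K ('ker f)) mulnC; congr (_ * _)%N.
    congr #|pred_of_set _|; apply/eqP; rewrite eqEsubset subsetI kK subsetIr /=.
    by rewrite setSI.
  rewrite big_map; apply/eqP; rewrite -(eqn_pmul2r (cardG_gt0 ('ker_G f))).
  by rewrite [X in X == _]mulnAC !cardE // ?subsetIl // cardG.
Qed.

(** * Two-transitive actions *)

Section Pairing.

Variables (gT : finGroupType) (G H : {group gT}) (s a : gT) (n l : nat).
Hypotheses (sHG : H \subset G) (Gs : s \in G) (Ga : a \in G) (n0 : 0 < n).
(** In terms of the right cosets of [H]: [a ^+ j] fixes none of them for 0 < j < n, and
    [a ^+ (2 * n)] fixes all. The orbits of [a] thus have length n or 2n. *)
Hypothesis free : forall g j, g \in G -> 0 < j < n -> g * a ^+ j * g^-1 \notin H.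
Hypothesis triv : forall g, g \in G -> g * a ^+ (2 * n) * g^-1 \in H.

Let Omega := rcosets H G.
Let shift X j := X :* a ^+ j.

Let shiftD X i j : shift (shift X i) j = shift X (i + j).
Proof. by rewrite /shift -rcosetM -expgD. Qed.

Let shift_Omega X j : X \in Omega -> shift X j \in Omega.
Proof.
by case/rcosetsP=> g Gg ->; apply/rcosetsP; exists (g * a ^+ j); rewrite ?groupM ?groupX // rcosetM.
Qed.

Let shift_free X j : X \in Omega -> 0 < j < n -> shift X j != X.
Proof.
case/rcosetsP=> g Gg -> jn; apply/eqP=> E.
have : g * a ^+ j \in H :* g by rewrite -E /shift -rcosetM rcoset_refl.
by rewrite mem_rcoset; apply/negP/free.
Qed.

Let shift_triv X : X \in Omega -> shift X (2 * n) = X.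
Proof.
case/rcosetsP=> g Gg ->; rewrite /shift -rcosetM.
by apply: rcoset_eqP; rewrite mem_rcoset triv.
Qed.

Let shift_mod X j : X \in Omega -> shift X j = shift X (j %% (2 * n)).
Proof.
move=> OX; rewrite {1}(divn_eq j (2 * n)) addnC -shiftD.
elim: (j %/ _) => [|k IHk]; first by rewrite mul0n /shift expg0 rcoset1.
by rewrite mulSn -shiftD shift_triv // shift_Omega.
Qed.

Let shift_inj X i j :
  X \in Omega -> shift X i = shift X j -> i <= j -> shift X (j - i) = X.
Proof.
move=> OX E ij; have : shift (shift X (j - i)) i = shift X i by rewrite shiftD subnK.
by rewrite /shift => /rcoset_inj.
Qed.

Let Orb X : {set {set gT}} := [set shift X (val j) | j : 'I_(2 * n)].

Let OrbP X Y : X \in Omega -> reflect (exists j, Y = shift X j) (Y \in Orb X).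
Proof.
move=> OX; apply: (iffP imsetP) => [[j _ ->]|[j ->]]; first by exists j.
have jn : j %% (2 * n) < 2 * n by rewrite ltn_mod muln_gt0.
by exists (Ordinal jn) => //; apply: shift_mod.
Qed.

Let Orb_sub X : X \in Omega -> Orb X \subset Omega.
Proof. by move=> OX; apply/subsetP=> Y /(OrbP _ OX)[j ->]; apply: shift_Omega. Qed.

Let Orb_refl X : X \in Omega -> X \in Orb X.
Proof. by move=> OX; apply/OrbP => //; exists 0; rewrite /shift expg0 rcoset1. Qed.

Let Orb_eq X Y : X \in Omega -> Y \in Orb X -> Orb Y = Orb X.
Proof.
move=> OX YX; have OY := subsetP (Orb_sub OX) _ YX.
have [j EY] := OrbP _ OX YX.
have [i EX] : exists i, X = shift Y i.
  have lt : j %% (2 * n) < 2 * n by rewrite ltn_mod muln_gt0.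
  exists (2 * n - j %% (2 * n))%N; rewrite EY (shift_mod j) // shiftD subnKC ?(ltnW lt) //.
  by rewrite shift_triv.
apply/setP=> Z; apply/OrbP/OrbP => // -[k ->].
  by exists (j + k)%N; rewrite EY shiftD.
by exists (i + k)%N; rewrite [in LHS]EX shiftD.
Qed.

Let rho (O : {set {set gT}}) := odflt set0 [pick X in O].
(** Base points from which the powers a^j, j < n, sweep out the orbit; the two coincide if its
    length is n. *)
Let pair O := [set rho O; shift (rho O) n].
Let P := [set Orb X | X in Omega].

Let rhoP O : O \in P -> rho O \in O /\ O = Orb (rho O).
Proof.
case/imsetP=> X OX ->; rewrite /rho; case: pickP => [Y YX|/(_ X)]; last by rewrite Orb_refl.
by split=> //; rewrite (Orb_eq OX).
Qed.

Let rho_Omega O : O \in P -> rho O \in Omega.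
Proof. by move=> /[dup] /rhoP[r _] /imsetP[X OX E]; apply: (subsetP (Orb_sub OX)); rewrite -E. Qed.

(** If the two base points differ, the 2n shifts of [X] are distinct: a coincidence at distance d is
    excluded by freeness for d < n, by the assumption for d = n, and for d > n because [X] would
    also be fixed at distance 2n - d < n. *)
Let card_pair O : O \in P -> #|pair O| * n <= #|O|.
Proof.
move=> PO; have [rO EO] := rhoP PO; have OX := rho_Omega PO; set X := rho O in rO EO OX.
have shift_ne i j : i < j -> j - i < n -> shift X i != shift X j.
  move=> ij jn; apply/eqP=> E; have := shift_free OX (j := (j - i)%N).
  by rewrite subn_gt0 ij jn (shift_inj OX E) ?(ltnW ij) // eqxx => /(_ isT).
have sub m : [set shift X (val j) | j : 'I_m] \subset O.
  by rewrite EO; apply/subsetP=> _ /imsetP[j _ ->]; apply/OrbP => //; exists (val j).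
rewrite cards2 -/X; have [Xn|Xn] := eqVneq X (shift X n).
  rewrite mul1n -[n]card_ord -(card_imset (f := fun j : 'I_n => shift X j)).
    exact: subset_leq_card.
  move=> i j E; apply: val_inj; case: (ltngtP i j) => // ij.
    by have := shift_ne _ _ ij (leq_ltn_trans (leq_subr _ _) (ltn_ord j)); rewrite E eqxx.
  by have := shift_ne _ _ ij (leq_ltn_trans (leq_subr _ _) (ltn_ord i)); rewrite E eqxx.
rewrite -[(_.+1 * n)%N]card_ord -(card_imset (f := fun j : 'I_(2 * n) => shift X j)).
  exact: subset_leq_card.
have aux (i j : 'I_(2 * n)) : i < j -> shift X i != shift X j.
  move=> ij; apply/eqP=> E; have Ed := shift_inj OX E (ltnW ij).
  have d2 : j - i < 2 * n by apply: leq_ltn_trans (leq_subr _ _) (ltn_ord j).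
  have d0 : 0 < j - i by rewrite subn_gt0.
  case: (ltngtP (j - i) n) => dn.
  - by have := shift_free OX (j := (j - i)%N); rewrite d0 dn Ed eqxx => /(_ isT).
  - have E2 : shift X (2 * n - (j - i)) = X.
      by rewrite -[X in shift X _ = _]Ed shiftD subnKC ?(ltnW d2) // shift_triv.
    have := shift_free OX (j := (2 * n - (j - i))%N).
    have lt : 2 * n - (j - i) < n.
      by rewrite ltn_subLR ?(ltnW d2) // [X in X < _]mul2n -addnn ltn_add2r.
    by rewrite E2 eqxx subn_gt0 d2 lt => /(_ isT).
  - by rewrite -dn Ed eqxx in Xn.
move=> i j E; apply: val_inj; case: (ltngtP i j) => // [/aux|/aux]; by rewrite E eqxx.
Qed.

Let Delta := \bigcup_(O in P) pair O.

Let sum_orbits : \sum_(O in P) #|O| = #|Omega|.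
Proof.
apply/esym/card_partition/and3P; split.
- rewrite eqEsubset; apply/andP; split.
    by apply/bigcupsP=> _ /imsetP[X OX ->]; apply: Orb_sub.
  by apply/subsetP=> X OX; apply/bigcupP; exists (Orb X); [apply: imset_f|apply: Orb_refl].
- apply/trivIsetP=> _ _ /imsetP[X OX ->] /imsetP[Y OY ->] ne.
  rewrite -setI_eq0; apply: contraR ne => /set0Pn[Z /setIP[ZX ZY]].
  by rewrite -(Orb_eq OX ZX) (Orb_eq OY ZY).
- by apply/imsetP=> -[X OX E]; have := Orb_refl OX; rewrite -E inE.
Qed.

Let Delta_Omega : Delta \subset Omega.
Proof.
apply/bigcupsP=> O PO; rewrite subUset !sub1set shift_Omega ?andbT; exact: rho_Omega.
Qed.

Let Delta_cover X : X \in Omega -> exists Y j, [/\ Y \in Delta, j < n & X = shift Y j].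
Proof.
move=> OX; have PO : Orb X \in P by apply: imset_f.
have [rO EO] := rhoP PO; have OY := rho_Omega PO; set Y := rho _ in rO EO OY.
have /imsetP[i _ EX] : X \in Orb Y by rewrite -EO Orb_refl.
have [lt|ge] := ltnP i n.
  by exists Y, (val i); split=> //; apply/bigcupP; exists (Orb X) => //; rewrite /pair !inE eqxx.
exists (shift Y n), (i - n)%N; split.
- by apply/bigcupP; exists (Orb X) => //; rewrite /pair !inE eqxx orbT.
- by rewrite ltn_subLR // addnn -mul2n.
- by rewrite shiftD subnKC.
Qed.

(** The last hypothesis carries the base pair (H, H s) to any pair of distinct cosets. The blocks
    are {1, s}, a set of l such elements t, and those of the powers of [a]. *)
Lemma tiling_pairs : prime l -> (#|G : H| = 2 * l * n)%N ->
  (forall g1 g2, g1 \in G -> g2 \in G -> g1 * g2^-1 \notin H ->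
    exists t, [/\ t \in G, t * g1^-1 \in H & s * t * g2^-1 \in H]) ->
  exists b, tiling G H b.
Proof.
move=> pl ixH trans2.
have trans2' X Y : X \in Omega -> Y \in Omega -> X != Y ->
    exists t, [&& t \in G, t \in X & s * t \in Y].
  case/rcosetsP=> g1 Gg1 -> /rcosetsP[g2 Gg2 ->] ne.
  have ne' : g1 * g2^-1 \notin H.
    by apply: contra ne => h; apply/eqP/rcoset_eqP; rewrite mem_rcoset.
  by have [t [Gt t1 t2]] := trans2 g1 g2 Gg1 Gg2 ne'; exists t; rewrite Gt !mem_rcoset t1.
(* The bound on each pair gives one inequality, the cover of [Omega] by n shifts of [Delta] the
   other. *)
have cardD : #|Delta| = (2 * l)%N.
  apply/eqP; rewrite eqn_leq -(leq_pmul2r n0) -ixH -[#|G : H|]/(#|Omega|).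
  rewrite -[X in _ && X](leq_pmul2r n0) -ixH -[#|G : H|]/(#|Omega|); apply/andP; split.
    have le : #|Delta| <= \sum_(O in P) #|pair O|.
      rewrite /Delta; elim/big_rec2: _ => [|O k D PO le]; first by rewrite cards0.
      by rewrite (leq_trans (leq_card_setU _ _)) ?leq_add2l.
    apply: leq_trans (leq_mul le (leqnn n)) _; rewrite -sum_orbits big_distrl /=.
    by apply: leq_sum => O; apply: card_pair.
  rewrite -[n in X in _ <= X]card_ord -cardsT -cardsX.
  apply: leq_trans (leq_imset_card (fun u => shift u.1 (val u.2)) _).
  apply: subset_leq_card; apply/subsetP=> X /Delta_cover[Y [j [DY jn ->]]].
  by apply/imsetP; exists (Y, Ordinal jn); rewrite ?inE ?DY.
pose d := nth set0 (enum Delta).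
have sized : size (enum Delta) = (2 * l)%N by rewrite -cardE.
have dO k : k < 2 * l -> d k \in Omega.
  by rewrite -sized => kl; apply: (subsetP Delta_Omega); rewrite -mem_enum mem_nth.
(* Consecutive points of an arbitrary enumeration are matched; they need not belong to one orbit of
   [a]. The default 1 does not occur for i < l. *)
pose t i := odflt 1 [pick t | [&& t \in G, t \in d (2 * i)%N & s * t \in d (2 * i).+1]].
have tP i : i < l -> [&& t i \in G, t i \in d (2 * i)%N & s * t i \in d (2 * i).+1].
  move=> il; rewrite /t; case: pickP => //= none.
  have i2 : (2 * i).+1 < 2 * l by rewrite -[(2 * i).+2]/(2 + 2 * i)%N -mulnS leq_mul2l.
  have [|t' Ht] := trans2' (d (2 * i)%N) (d (2 * i).+1) (dO _ (ltnW i2)) (dO _ i2).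
    by rewrite nth_uniq ?sized ?(ltnW i2) ?enum_uniq // neq_ltn ltnSn.
  by rewrite none in Ht.
have [b [Bb Eb Cb]] := powers_blocks a n0.
exists (([set 1; s], 2) :: ([set t (val i) | i : 'I_l], l) :: b); split.
- move=> x; rewrite !inE => /or3P[/eqP->|/eqP->|xb] /=.
  + by split=> //; rewrite ?subUset ?sub1set ?group1 // cards2; case: (_ != _).
  + split=> //; last by rewrite (leq_trans (leq_imset_card _ _)) // cardT size_enum_ord.
    by apply/subsetP=> _ /imsetP[i _ ->]; have /and3P[] := tP i (ltn_ord i).
  + have [sx ? ?] := Bb x xb; split=> //; apply: subset_trans sx _; by rewrite cycle_subG.
- apply/subsetP=> g Gg.
  have /Delta_cover[Y [j [DY jn E]]] : H :* g \in Omega by apply/rcosetsP; exists g.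
  have := DY; rewrite -mem_enum => /(nthP set0)[k]; rewrite sized => kl; rewrite -/(d k) => EY.
  have kl2 : k./2 < l by rewrite ltn_half_double -mul2n.
  have /and3P[Gt t1 t2] := tP _ kl2.
  (* The parity of the position of [Y] selects 1 or [s], half the position selects the element t. *)
  have [u [us utY]] : exists u, u \in [set 1; s] /\ u * t k./2 \in Y.
    rewrite -EY -(odd_double_half k) -mul2n.
    have -> : (odd k + 2 * k./2)./2 = k./2 by rewrite mul2n half_bit_double.
    by case: (odd k); [exists s|exists 1]; rewrite !inE eqxx ?orbT ?mul1g.
  have gin : g \in H :* (u * t k./2 * a ^+ j).
    have -> : H :* (u * t k./2 * a ^+ j) = H :* g.
      rewrite E; have [h Gh EYh] := rcosetsP (subsetP Delta_Omega _ DY).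
      by rewrite /shift rcosetM EYh; congr (_ :* _); apply/rcoset_eqP; rewrite -EYh.
    exact: rcoset_refl.
  case/rcosetP: gin => h Hh ->; rewrite !big_cons /=.
  rewrite -!mulgA; apply: mem_mulg => //; apply: mem_mulg => //.
  apply: mem_mulg; last exact: Cb.
  by apply/imsetP; exists (Ordinal kl2).
- by rewrite !big_cons /= Eb -(Lagrange sHG) ixH !mulnA.
Qed.

End Pairing.

(** * Finite fields of square order and unitary matrices *)

Local Open Scope ring_scope.

Lemma finField_prim_root (F : finFieldType) :
  exists z : F, (#|F|.-1).-primitive_root z.
Proof.
have F1 : (0 < #|F|.-1)%N by rewrite -ltnS prednK ?finNzRing_gt1 // ltnW ?finNzRing_gt1.
pose rs := [seq x <- enum F | x != 0].
have size_rs : size rs = #|F|.-1.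
  rewrite -(cardC1 (0 : F)) cardE /rs; congr size.
  by rewrite {2}/enum_mem enumT; apply: eq_filter.
have /hasP[z _ pz] : has (#|F|.-1).-primitive_root rs.
  apply: has_prim_root => //; last by rewrite size_rs.
    apply/allP=> x; rewrite mem_filter => /andP[x0 _].
    rewrite unity_rootE -(inj_eq (mulfI x0)) -exprS prednK ?expf_card ?mulr1 //.
    by rewrite ltnW ?finNzRing_gt1.
  by rewrite filter_uniq ?enum_uniq.
by exists z.
Qed.

Lemma expn_rmorphism (F : fieldType) (p k : nat) :
  p \in [pchar F] -> exists theta : {rmorphism F -> F}, forall x, theta x = x ^+ (p ^ k).
Proof.
move=> pF; elim: k => [|k [theta IHk]].
  by exists (GRing.RMorphism.clone _ _ (@idfun F) _) => x; rewrite expn0 expr1.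
exists (GRing.RMorphism.clone _ _ (pFrobenius_aut pF \o theta) _) => x /=.
by rewrite pFrobenius_autE IHk -exprM expnSr.
Qed.

Section QuadraticField.

Variables (F : finFieldType) (q : nat) (theta : {rmorphism F -> F}).
Hypotheses (thetaE : forall x, theta x = x ^+ q) (oddq : odd q).
Hypotheses (q_gt2 : (2 < q)%N) (cardF : #|F| = (q ^ 2)%N) (two0 : 2%:R != 0 :> F).

Lemma thetaK : involutive theta.
Proof. by move=> x; rewrite !thetaE -exprM -[(q * q)%N]/(q ^ 2)%N -cardF expf_card. Qed.

Lemma card_predE : #|F|.-1 = ((q + 1) * (q - 1))%N.
Proof. by rewrite cardF -subn1 -{2}(exp1n 2) subn_sqr mulnC. Qed.

Lemma prim_root_q2 : exists lam : F, ((q + 1) * (q - 1)).-primitive_root lam.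
Proof. by rewrite -card_predE; apply: finField_prim_root. Qed.

(** A nonzero fixed element is a (q - 1)-st root of unity, hence a power of [lam ^+ (q + 1)], the
    norm of the primitive element [lam]. *)
Lemma norm_surj (a : F) : theta a = a -> exists c, c * theta c = a.
Proof.
move=> ta; have [->|a0] := eqVneq a 0; first by exists 0; rewrite mul0r.
have [lam pl] := prim_root_q2.
have pm : (q - 1).-primitive_root (lam ^+ (q + 1)).
  by have := exp_prim_root pl (q + 1); rewrite gcdnMr mulKn ?addn1.
have : a ^+ (q - 1) = 1.
  apply: (mulfI a0); rewrite -exprS mulr1 -[in RHS]ta thetaE subn1 prednK //.
  by apply: ltn_trans q_gt2.
case/(prim_rootP pm) => i ->; exists (lam ^+ i).
by rewrite thetaE -!exprM -exprD; congr (_ ^+ _); lia.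
Qed.

Lemma prim_root_norm1 : exists c1 : F, (q + 1).-primitive_root c1.
Proof.
have [lam pl] := prim_root_q2; exists (lam ^+ (q - 1)).
by have := exp_prim_root pl (q - 1); rewrite gcdnMl mulnK // subn_gt0 (ltn_trans _ q_gt2).
Qed.

Lemma theta_unit_norm1 (c : F) : c * theta c = 1 -> c ^+ (q + 1) = 1.
Proof. by rewrite thetaE -exprS addn1. Qed.

Lemma norm1_theta (c : F) : c ^+ (q + 1) = 1 -> c * theta c = 1.
Proof. by rewrite thetaE -exprS addn1. Qed.

(** Multiplication by one nonzero such element [m] is a bijection from the fixed field. For m =
    lam^((q+1)/2) with [lam] primitive, m^(q-1) is the square root -1 of 1. *)
Lemma card_theta_neg : #|[set d : F | theta d == - d]| = q.
Proof.
have [lam pl] := prim_root_q2.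
have l0 : lam != 0.
  apply/eqP=> E; have := prim_expr_order pl; rewrite E expr0n muln_eq0 addn1 /= subn_eq0.
  by rewrite leqNgt (ltn_trans _ q_gt2) //= => /esym/eqP; rewrite oner_eq0.
pose k := ((q + 1) %/ 2)%N; have k2 : (k * 2 = q + 1)%N by rewrite divnK // dvdn2 addn1 /= oddq.
pose m := lam ^+ k; have m0 : m != 0 by rewrite expf_neq0.
have mm : m ^+ (q - 1) = -1.
  have : (m ^+ (q - 1)) ^+ 2 = 1.
    by rewrite /m -!exprM [((q - 1) * 2)%N]mulnC mulnA k2 (prim_expr_order pl).
  move/eqP; rewrite sqrf_eq1 => /orP[|/eqP//]; rewrite -exprM.
  rewrite -(prim_order_dvd pl) => /dvdn_leq; rewrite muln_gt0 -k2; lia.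
have tm : theta m = - m.
  by rewrite thetaE -[q in LHS](subnK (_ : 1 <= q)%N) ?(ltn_trans _ q_gt2) // addn1 exprSr mm mulN1r.
have -> : [set d | theta d == - d] = [set m * x | x in [set x | theta x == x]].
  apply/setP=> d; rewrite inE; apply/eqP/imsetP => [td|[x]]; last first.
    by rewrite inE => /eqP tx ->; rewrite rmorphM tm tx mulNr.
  exists (d / m); last by rewrite mulrC divfK.
  by rewrite inE fmorph_div td tm invrN mulrNN.
rewrite card_imset; last exact: mulfI.
have pm : (q - 1).-primitive_root (lam ^+ (q + 1)).
  by have := exp_prim_root pl (q + 1); rewrite gcdnMr mulKn ?addn1.
have -> : [set x | theta x == x] = 0 |: [set (lam ^+ (q + 1)) ^+ (val i) | i : 'I_(q - 1)].
  have qS : q = (q - 1).+1 by lia.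
  apply/setP=> x; rewrite !inE thetaE; have [->|x0] /= := eqVneq x 0.
    by rewrite expr0n gtn_eqF ?eqxx // (ltn_trans _ q_gt2).
  rewrite [q in LHS]qS exprS -[X in _ == X]mulr1 (inj_eq (mulfI x0)).
  apply/eqP/imsetP => [/(prim_rootP pm)[i ->]|[i _ ->]]; first by exists i.
  by rewrite -exprM mulnC exprM (prim_expr_order pm) expr1n.
rewrite cardsU1 card_imset; last first.
  by move=> i j /eqP; rewrite (eq_prim_root_expr pm) !(modn_small (ltn_ord _)) => /eqP/val_inj.
rewrite card_ord; case: imsetP => [[i _ /esym/eqP]|_]; last by lia.
by rewrite !expf_eq0 (negPf l0) !andbF.
Qed.

(** Since 4 divides q^2 - 1, -1 is a square, so that for a primitive element n also - n represents
    the class of nonsquares. The sign is that of the form x^2 - n y^2 at (0, 1). *)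
Lemma nonsquare_exists : exists n : F,
  (forall x, x ^+ 2 != n) /\
  (forall m, m != 0 -> exists2 y, y != 0 & m = y ^+ 2 \/ m = - n * y ^+ 2).
Proof.
have [lam pl] := prim_root_q2.
have N0 : (0 < (q + 1) * (q - 1))%N by rewrite muln_gt0; lia.
have [k k2] : exists k, ((q + 1) * (q - 1) = 4 * k)%N.
  exists (((q + 1) %/ 2) * ((q - 1) %/ 2))%N.
  have := odd_double_half q; rewrite oddq -mul2n; set h := q./2 => <-.
  have -> : (1 + 2 * h + 1 = h.+1 * 2)%N by lia.
  by rewrite [(1 + _)%N]addnC addnK [(2 * h)%N]mulnC !mulnK //; lia.
have l0 : lam != 0.
  apply/eqP=> E; have := prim_expr_order pl; rewrite E expr0n gtn_eqF //.
  by move/esym/eqP; rewrite oner_eq0.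
have nz x : x != 0 -> exists i, x = lam ^+ i.
  move=> x0; have : x ^+ ((q + 1) * (q - 1)) = 1.
    apply: (mulfI x0); rewrite -exprS mulr1 -card_predE prednK ?expf_card //.
    by rewrite (cardD1 0) inE.
  by case/(prim_rootP pl)=> i ->; exists i.
have mk : lam ^+ (2 * k) = -1.
  have : (lam ^+ (2 * k)) ^+ 2 = 1.
    by rewrite -exprM (_ : 2 * k * 2 = (q + 1) * (q - 1))%N ?(prim_expr_order pl) // k2; lia.
  move/eqP; rewrite sqrf_eq1 => /orP[|/eqP//].
  rewrite -(prim_order_dvd pl) => /dvdn_leq; lia.
exists lam; split=> [x|m /nz[i ->]].
  apply/eqP=> E; have x0 : x != 0 by apply: contraNneq l0 => x0; rewrite -E x0 expr0n.
  have [i Ex] := nz x x0; have : lam ^+ (i * 2) == lam ^+ 1 by rewrite expr1 exprM -Ex E.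
  rewrite (eq_prim_root_expr pl) k2 => /eqP/(congr1 odd).
  by rewrite !odd_mod ?oddM ?andbF.
have := odd_double_half i; rewrite -mul2n; case: (odd i) => <-.
  (* The summand [k] contributes a square root of -1. *)
  exists (lam ^+ (k + i./2)); first by rewrite expf_neq0.
  have -> : (lam ^+ (k + i./2)) ^+ 2 = - lam ^+ (2 * i./2).
    by rewrite -exprM mulnDl exprD [(k * 2)%N]mulnC mk mulN1r [(_ * 2)%N]mulnC.
  by right; rewrite mulrNN -exprS add1n.
exists (lam ^+ i./2); first by rewrite expf_neq0.
by left; rewrite -exprM mulnC.
Qed.

Lemma norm_exists_neg1 : exists c : F, c * theta c = -1.
Proof. by apply: norm_surj; rewrite rmorphN1. Qed.

Definition adj m n (A : 'M[F]_(m, n)) : 'M_(n, m) := (map_mx theta A)^T.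

Lemma adjE m n (A : 'M_(m, n)) i j : adj A i j = theta (A j i).
Proof. by rewrite /adj 2!mxE. Qed.

Lemma form_entry m n (A B : 'M[F]_(m, n)) M i j :
  (A *m M *m adj B) i j = (row i A *m M *m adj (row j B)) 0 0.
Proof.
rewrite -row_mul [LHS]mxE [RHS]mxE; apply: eq_bigr => l _.
by rewrite !adjE [row i _ _ _]mxE [row j _ _ _]mxE.
Qed.

Lemma adjM m n p (A : 'M_(m, n)) (B : 'M_(n, p)) : adj (A *m B) = adj B *m adj A.
Proof. by rewrite /adj map_mxM trmx_mul. Qed.

Lemma adjK m n (A : 'M_(m, n)) : adj (adj A) = A.
Proof. by apply/matrixP=> i j; rewrite !mxE thetaK. Qed.

Lemma adjZ m n a (A : 'M_(m, n)) : adj (a *: A) = theta a *: adj A.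
Proof. by apply/matrixP=> i j; rewrite !mxE rmorphM. Qed.

Lemma adj1 n : adj (1%:M : 'M_n) = 1%:M.
Proof. by rewrite /adj map_mx1 trmx1. Qed.

Lemma det_adj n (A : 'M_n) : \det (adj A) = theta (\det A).
Proof. by rewrite /adj det_tr det_map_mx. Qed.

Lemma adjD m n (A B : 'M_(m, n)) : adj (A + B) = adj A + adj B.
Proof. by rewrite /adj map_mxD linearD. Qed.

Lemma adj0 m n : adj (0 : 'M_(m, n)) = 0.
Proof. by rewrite /adj map_mx0 trmx0. Qed.

Lemma adj_block m1 m2 n1 n2 (A : 'M_(m1, n1)) (B : 'M_(m1, n2)) (C : 'M_(m2, n1))
    (D : 'M_(m2, n2)) :
  adj (block_mx A B C D) = block_mx (adj A) (adj C) (adj B) (adj D).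
Proof. by rewrite /adj map_block_mx tr_block_mx. Qed.

Lemma adj_col m1 m2 n (A : 'M_(m1, n)) (B : 'M_(m2, n)) :
  adj (col_mx A B) = row_mx (adj A) (adj B).
Proof. by rewrite /adj map_col_mx tr_col_mx. Qed.

Lemma unitary_unit n (A : 'M_n) : A *m adj A = 1%:M -> A \in unitmx.
Proof. by move/mulmx1_unit=> []. Qed.

Lemma unitary_det n (A : 'M_n) : A *m adj A = 1%:M -> \det A * theta (\det A) = 1.
Proof. by move/(congr1 determinant); rewrite det_mulmx det_adj det1. Qed.

(** Two frames with the same Gram matrix differ by a unitary matrix; this is the source of unitary
    elements with prescribed images of vectors. *)
Lemma frame_unitary n (R0 R J : 'M_n) :
  J \in unitmx -> R0 *m adj R0 = J -> R *m adj R = J ->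
  [/\ R0 \in unitmx, R \in unitmx
    & (invmx R0 *m R) *m adj (invmx R0 *m R) = 1%:M].
Proof.
move=> uJ E0 E.
have uR0 : R0 \in unitmx by move: uJ; rewrite -E0 unitmx_mul => /andP[].
have uR : R \in unitmx by move: uJ; rewrite -E unitmx_mul => /andP[].
split=> //; rewrite adjM mulmxA -[_ *m R *m _]mulmxA E -E0 mulmxA mulVmx // mul1mx.
by rewrite -adjM mulVmx // adj1.
Qed.

(** Gram-Schmidt: a vector of nonzero norm is scaled to norm 1 and split off, and induction applies
    to its orthogonal complement. *)
Lemma herm_orthonormal n (M : 'M[F]_n) :
  adj M = M -> M \in unitmx -> exists P : 'M[F]_n, P *m M *m adj P = 1%:M.
Proof.
elim: n M => [|n IHn] M hM uM; first by exists 0; apply/matrixP=> -[].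
have [v vM] : exists v : 'rV_n.+1, (v *m M *m adj v) 0 0 != 0.
  apply/existsP; apply: contraLR uM => /existsPn none.
  have h0 (u w : 'rV_n.+1) : (u *m M *m adj w) 0 0 = 0.
    set x := (u *m M *m adj w) 0 0; apply/eqP; apply/negPn/negP=> x0.
    have hx : (w *m M *m adj u) 0 0 = theta x.
      have -> : w *m M *m adj u = adj (u *m M *m adj w) by rewrite !adjM adjK hM mulmxA.
      by rewrite adjE.
    (* When [u] and [w] have norm 0 and product [x], this vector has norm 1 + 1. *)
    have := none (x^-1 *: u + w); rewrite negbK -trace_mx11 adjD adjZ !mulmxDr !mulmxDl.
    rewrite -!scalemxAl -!scalemxAr !mxtraceD !mxtraceZ !trace_mx11 -/x hx.
    have /negPn/eqP := none u; have /negPn/eqP := none w => -> ->.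
    rewrite !mulr0 addr0 add0r mulVf // fmorphV mulVf ?fmorph_eq0 //.
    by rewrite -[1 + 1]/(2%:R) (negPf two0).
  have -> : M = 0; last by rewrite unitmxE det0 unitr0.
  apply/matrixP=> i j; rewrite [RHS]mxE -(h0 (delta_mx 0 i) (delta_mx 0 j)).
  by rewrite /adj map_delta_mx trmx_delta -rowE -colE !mxE.
set al := (v *m M *m adj v) 0 0 in vM.
have vMs : v *m M *m adj v = al%:M by rewrite [LHS]mx11_scalar.
(* [al] is fixed by [theta] because [M] is hermitian, so the norm map reaches its inverse. *)
have [s sE] : exists s, s * theta s = al^-1.
  apply: norm_surj; rewrite fmorphV; congr (_^-1).
  have : adj (v *m M *m adj v) = v *m M *m adj v by rewrite !adjM adjK hM mulmxA.
  by move/matrixP/(_ 0 0); rewrite adjE.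
pose w := s *: v; pose W := M *m adj w.
have wW : w *m W = 1%:M.
  rewrite /W /w adjZ -scalemxAr -scalemxAl -scalemxAr scalerA mulmxA vMs scale_scalar_mx.
  by rewrite sE mulVf.
have rW : \rank W = 1%N.
  apply/eqP; rewrite eqn_leq rank_leq_col lt0n mxrank_eq0; apply/eqP=> W0.
  by move: wW; rewrite W0 mulmx0 => /matrixP/(_ 0 0)/eqP; rewrite !mxE eq_sym oner_eq0.
(* The rows of [A] are a basis of the orthogonal complement of [w]. *)
have [A [AW fA]] : exists A : 'M_(n, n.+1), A *m W = 0 /\ row_free A.
  have rN : \rank (kermx W) = n by rewrite mxrank_ker rW subn1.
  have : exists A : 'M_(\rank (kermx W), n.+1), A *m W = 0 /\ row_free A.
    exists (row_base (kermx W)); rewrite row_base_free; split=> //.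
    by apply/sub_kermxP; rewrite eq_row_base.
  by rewrite rN.
pose P0 : 'M_(1 + n) := col_mx w A.
have uP0 : P0 \in unitmx.
  rewrite -row_free_unit; apply: inj_row_free => x; rewrite -[x]hsubmxK mul_row_col => x0.
  have l0 : lsubmx x = 0.
    have := congr1 (mulmx^~ W) x0; rewrite mulmxDl -!mulmxA wW AW mulmx0 addr0 mulmx1.
    by rewrite mul0mx.
  move: x0; rewrite l0 mul0mx add0r => /eqP; rewrite mulmx_free_eq0 // => /eqP->.
  by rewrite row_mx0.
have P0M : P0 *m M *m adj P0 = block_mx 1%:M 0 0 (A *m M *m adj A).
  rewrite /P0 adj_col mul_col_mx mul_col_row; congr block_mx.
  - by rewrite -mulmxA.
  - have -> : w *m M *m adj A = adj (A *m W) by rewrite /W !adjM adjK hM.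
    by rewrite AW adj0.
  - by rewrite -mulmxA.
have [||P' P'M] := IHn (A *m M *m adj A).
- by rewrite !adjM adjK hM mulmxA.
- have : P0 *m M *m adj P0 \in unitmx.
    by rewrite !unitmx_mul uP0 uM /adj unitmx_tr map_unitmx.
  by rewrite P0M unitmxE det_ublock det1 mul1r.
pose B : 'M[F]_(1 + n) := block_mx 1%:M 0 0 P'.
have aB : adj B = block_mx 1%:M 0 0 (adj P') by rewrite /B adj_block adj1 !adj0.
have : B *m P0 *m M *m adj (B *m P0) = 1%:M.
  rewrite (adjM B P0) -!mulmxA [P0 *m _]mulmxA [P0 *m M *m _]mulmxA P0M aB.
  rewrite !mulmx_block !(mul0mx, mulmx0, mul1mx, mulmx1, addr0, add0r).
  by rewrite mulmxA P'M -scalar_mx_block.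
by exists (B *m P0).
Qed.
End QuadraticField.

(** [L] is the splitting field of X^m - X. The roots are the fixed points of the n-th power of the
    Frobenius automorphism over [F], hence a subfield, hence all of [L]; as the polynomial is
    separable, [L] has m elements. *)
Lemma finField_extension (F : finFieldType) (n : nat) :
  (0 < n)%N -> exists L : fieldExtType F, \dim {:L} = n.
Proof.
move=> n_gt0; set m := (#|F| ^ n)%N.
have F1 := finNzRing_gt1 F.
have m_gt1 : (m > 1)%N by rewrite -(exp1n n) ltn_exp2r.
have m_gt0 := ltnW m_gt1; have m1_gt0 : (m.-1 > 0)%N by rewrite -ltnS prednK.
pose Q (R : nzRingType) : {poly R} := 'X^m - 'X.
have DQ (R : nzRingType) : Q R = ('X^(m.-1) - 1) * ('X - 0).
  by rewrite subr0 mulrBl mul1r -exprSr prednK.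
have /FinSplittingFieldFor[/= L splitLQ] : Q F != 0.
  by rewrite DQ monic_neq0 ?rpredM ?monicXsubC ?monicXnsubC.
rewrite [map_poly _ _]rmorphB rmorphXn /= map_polyX -/(Q L) in splitLQ.
have m0 : (m%:R : L) = 0.
  have F0 : (#|F|%:R : F) = 0.
    have := expg_cardG (in_setT (1 : F)).
    by rewrite FinRing.zmodXgE FinRing.zmod1gE cardsT.
  by rewrite natrX -(rmorph_nat (in_alg L)) F0 rmorph0 expr0n gtn_eqF.
have [zs DQL defL] := splitLQ.
have Uzs : uniq zs.
  rewrite -separable_prod_XsubC -(eqp_separable DQL) DQ separable_root andbC.
  rewrite /root !hornerE subr_eq0 eq_sym expr0n gtn_eqF ?oner_eq0 //=.
  rewrite cyclotomic.separable_Xn_sub_1 // -subn1 natrB // subr_eq0.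
  by rewrite m0 eq_sym oner_eq0.
have /finField_galois_generator[/= a _ Da] : (1 <= {:L})%VS by apply: sub1v.
rewrite dimv1 expn1 in Da.
pose Em := fixedSpace (a ^+ n)%g.
have in_zs : zs =i Em.
  move=> z; rewrite -root_prod_XsubC -(eqp_root DQL) (sameP fixedSpaceP eqP).
  rewrite /root !hornerE subr_eq0 /= /m; congr (_ == z).
  elim: (n) => [|i IHi]; first by rewrite gal_id.
  by rewrite expgSr expnSr exprM IHi galM ?Da ?memvf.
have defEm : Em = {:L}%VS.
  apply/eqP; rewrite eqEsubv subvf -defL -[Em]subfield_closed agenvS //.
  by rewrite subv_add sub1v; apply/span_subvP=> z; rewrite in_zs.
exists L; apply: (@expnI #|F|) => //; rewrite -/m.
rewrite -(card_vspace (fullv : {vspace (finvect_type L)})) card_vspacef.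
apply: succn_inj; transitivity (size (Q L)); last first.
  by rewrite size_polyDl size_polyXn // size_polyN size_polyX.
rewrite (eqp_size DQL) size_prod_XsubC; congr _.+1.
have /eq_card-> : finvect_type L =i zs by move=> z; rewrite in_zs defEm memvf.
exact/card_uniqP.
Qed.

(** * A Singer cycle of GU_3(q) *)

Section Singer.

Variables (F : finFieldType) (p k q : nat) (theta : {rmorphism F -> F}).
Hypotheses (thetaE : forall x, theta x = x ^+ q) (oddq : odd q).
Hypotheses (q_gt2 : (2 < q)%N) (cardF : #|F| = (q ^ 2)%N) (two0 : 2%:R != 0 :> F).
Hypotheses (pcharF : p \in [pchar F]) (qE : q = (p ^ k)%N).

(** The 3-space is modelled on the field [L] of q^6 elements with the hermitian form
    [phi (x * sg y)], where [sg] is x -> x^(q^3). An element [kap] of order q^3 + 1 satisfies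
    [kap * sg kap = 1], so multiplication by it preserves the form; an orthonormal basis turns the
    form into the standard one. *)
Lemma singer_cycle : exists S : 'M[F]_3,
  [/\ S *m adj theta S = 1%:M, exists c, S ^+ (q ^ 2 - q + 1) = c%:M
    & forall (x : 'rV_3) j c, x != 0 -> (0 < j < q ^ 2 - q + 1)%N -> x *m S ^+ j != c *: x].
Proof.
have [L dimL] := finField_extension F (isT : (0 < 3)%N).
have [r [r' rK r'K]] : exists (r : {linear L -> 'rV[F]_3}), exists2 r', cancel r r' & cancel r' r.
  have [r rlin [r' rK r'K]] : exists2 r : L -> 'rV[F]_3, linear r &
      exists2 r', cancel r r' & cancel r' r.
    have eB := vbasisP {:L}%VS; rewrite -dimL; exists (passmx.rVof (vbasis {:L})).
      exact: passmx.rVof_linear.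
    by exists (passmx.vecof (vbasis {:L})); [apply: passmx.rVofK | apply: passmx.vecofK].
  pose mix := GRing.isLinear.Build F L 'rV[F]_3 _ r rlin.
  pose rL : {linear L -> 'rV[F]_3} := HB.pack r mix.
  by exists rL, r'.
have pcharL : p \in [pchar L] by rewrite pchar_lalg.
have [sg sgE] := expn_rmorphism (3 * k) pcharL.
have {}sgE x : sg x = x ^+ (q ^ 3) by rewrite sgE mulnC expnM -qE.
pose K := FinFieldExtType L.
have cardK : #|K| = (q ^ 6)%N.
  have dimL' : \dim (fullv : {vspace (finvect_type L)}) = 3%N := dimL.
  have := card_vspace (fullv : {vspace (finvect_type L)}).
  by rewrite card_vspacef dimL' cardF -expnM.
have [z pz] := finField_prim_root K; rewrite cardK in pz.
have q1 : (1 < q)%N by apply: ltn_trans q_gt2.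
have q6 : ((q ^ 6).-1 = (q ^ 3 - 1) * (q ^ 3 + 1))%N.
  by rewrite -subn1 -{2}(exp1n 2) -[6%N]/(3 * 2)%N expnM subn_sqr.
have q3 : (q ^ 3 + 1 = (q ^ 2 - q + 1) * (q + 1))%N.
  have : (q <= q ^ 2)%N by rewrite -{1}[q]expn1 leq_exp2l.
  by move=> le; rewrite addnBAC // mulnBl; lia.
pose kap : L := z ^+ (q ^ 3 - 1).
have pk : (q ^ 3 + 1).-primitive_root kap.
  have := exp_prim_root pz (q ^ 3 - 1); rewrite q6 gcdnMr mulKn // subn_gt0.
  by rewrite -{1}(exp1n 3) ltn_exp2r.
have kap1 : kap * sg kap = 1 by rewrite sgE -exprS -addn1 (prim_expr_order pk).
have kap0 : kap != 0.
  by apply/eqP=> k0; move: kap1; rewrite k0 mul0r => /esym/eqP; rewrite oner_eq0.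
have sgK : involutive sg.
  move=> x; rewrite !sgE -exprM -expnD -cardK; exact: (@expf_card K).
(* On [F] the power q^3 is [theta] applied three times, that is, [theta]. *)
have sgZ a x : sg (a *: x) = theta a *: sg x.
  rewrite !sgE exprZn; congr (_ *: _).
  have : theta (theta (theta a)) = theta a by rewrite (thetaK thetaE cardF).
  by rewrite !thetaE -!exprM.
pose b i : L := r' (delta_mx 0 i).
have r'D x y : r' (x + y) = r' x + r' y by apply: (can_inj rK); rewrite linearD /= !r'K.
have decomp x : x = \sum_i r x 0 i *: b i.
  apply: (can_inj rK); rewrite linear_sum /= {1}(row_sum_delta (r x)).
  by apply: eq_bigr => i _; rewrite linearZ /= r'K.
have [phi [phiD phiZ phiS [x0 phi0]]] : exists phi : L -> F,
  [/\ {morph phi : x y / x + y}, forall a, {morph phi : x / a *: x >-> a * x},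
      forall x, phi (sg x) = theta (phi x) & exists x, phi x != 0].
  (* A coordinate functional scaled by [mu] and symmetrised under [sg]. *)
  pose f mu x := mu * r x 0 0 + theta (mu * r (sg x) 0 0).
  have fP mu : (exists x, f mu x != 0) -> exists phi : L -> F,
    [/\ {morph phi : x y / x + y}, forall a, {morph phi : x / a *: x >-> a * x},
      forall x, phi (sg x) = theta (phi x) & exists x, phi x != 0].
    exists (f mu); split=> // [x y|a x|x]; rewrite /f.
    - by rewrite rmorphD /= !linearD /= ![(_ + _ : 'M_(_,_)) 0 0]mxE !mulrDr rmorphD /=; ring.
    - rewrite sgZ !linearZ /= ![(_ *: _ : 'M_(_,_)) 0 0]mxE !rmorphM /=.
      by rewrite (thetaK thetaE cardF); ring.
    - by rewrite sgK rmorphD /= (thetaK thetaE cardF) addrC.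
  have r0 : r (b 0) 0 0 = 1 by rewrite /b r'K mxE !eqxx.
  have [ze ze0 zeN] : exists2 d : F, d != 0 & theta d = - d.
    have := card_theta_neg thetaE oddq q_gt2 cardF two0.
    rewrite (cardsD1 0) => E; have : [set d | theta d == - d] :\ 0 != set0.
      by apply/eqP=> D0; move: q_gt2; rewrite -E D0 cards0 addn0; case: (_ \in _).
    by case/set0Pn=> d /setD1P[d0]; rewrite inE => /eqP; exists d.
  (* If the two terms cancel for [mu = 1], then the scalar [ze], which [theta] negates, turns the
     cancellation into the value 2 ze. *)
  have [f10|f1] := eqVneq (f 1 (b 0)) 0; last by apply: (fP 1); exists (b 0).
  apply: (fP ze); exists (b 0); move: f10; rewrite /f r0 !mul1r !mulr1 rmorphM /= zeN.
  move/eqP; rewrite addrC addr_eq0 => /eqP->; rewrite mulrN1 opprK -mulr2n -mulr_natl.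
  by rewrite mulf_neq0.
have phi_sum I (s : seq I) (G : I -> L) : phi (\sum_(i <- s) G i) = \sum_(i <- s) phi (G i).
  by apply: (big_morph phi phiD); rewrite -(scale0r 0) phiZ mul0r.
pose M : 'M[F]_3 := \matrix_(i, j) phi (b i * sg (b j)).
have hE x y : (r x *m M *m adj theta (r y)) 0 0 = phi (x * sg y).
  rewrite {2}(decomp x) {2}(decomp y) mulr_suml phi_sum -mulmxA mxE.
  apply: eq_bigr => i _; rewrite -scalerAl phiZ; congr (_ * _).
  rewrite rmorph_sum mulr_sumr phi_sum mxE; apply: eq_bigr => j _.
  by rewrite sgZ -scalerAr phiZ mulrC adjE [M i j]mxE.
have hM : adj theta M = M.
  by apply/matrixP=> i j; rewrite adjE !mxE -phiS rmorphM /= sgK mulrC.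
have uM : M \in unitmx.
  rewrite -row_free_unit; apply: inj_row_free => v vM.
  apply/eqP; apply: contraR phi0 => v0.
  have rv0 : r' v != 0 by apply: contra v0 => /eqP rv; rewrite -[v]r'K rv linear0.
  (* Nondegeneracy: the second argument makes the product equal to [x0], where [phi] does not
     vanish. *)
  have := hE (r' v) (sg (x0 / r' v)); rewrite r'K vM mul0mx mxE sgK mulrC divfK //.
  by move=> <-.
have [P PM] := herm_orthonormal thetaE oddq q_gt2 cardF two0 hM uM.
have uP : P \in unitmx by have [] := mulmx1_unit (esym (etrans (esym PM) (esym (mulmxA _ _ _)))).
pose A : 'M[F]_3 := \matrix_i r (b i * kap).
have rA x : r x *m A = r (x * kap).
  rewrite {2}(decomp x) mulr_suml linear_sum mulmx_sum_row; apply: eq_bigr => i _.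
  by rewrite rowK -scalerAl linearZ.
have rAX x j : r x *m A ^+ j = r (x * kap ^+ j).
  elim: j x => [|j IHj] x; first by rewrite !expr0 mulr1 mulmx1.
  by rewrite exprS mulmxA rA IHj exprS mulrA.
have AMA : A *m M *m adj theta A = M.
  apply/matrixP=> i j; rewrite form_entry !rowK hE rmorphM /= mulrACA kap1 mulr1.
  by rewrite mxE.
have PVM : invmx P *m adj theta (invmx P) = M.
  transitivity (invmx P *m (P *m M *m adj theta P) *m adj theta (invmx P)).
    by rewrite PM mulmx1.
  by rewrite !mulmxA mulVmx // mul1mx -mulmxA -adjM mulVmx // adj1 mulmx1.
pose S := P *m A *m invmx P.
have SX j : S ^+ j = P *m A ^+ j *m invmx P.
  elim: j => [|j IHj]; first by rewrite !expr0 mulmx1 mulmxV.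
  rewrite exprS IHj; change (S *m (P *m A ^+ j *m invmx P) = P *m A ^+ j.+1 *m invmx P).
  by rewrite exprS -[A * _]/(A *m _) /S !mulmxA mulmxKV.
exists S; split.
- rewrite /S !adjM -!mulmxA [invmx P *m _]mulmxA PVM.
  by rewrite [M *m _]mulmxA [A *m _]mulmxA [A *m (M *m _)]mulmxA AMA mulmxA PM.
- have [lam pl] := prim_root_q2 cardF.
  have plL : ((q + 1) * (q - 1)).-primitive_root (lam%:A : L).
    by rewrite (fmorph_primitive_root (in_alg L)).
  (* A (q^2 - 1)-st root of unity lies in [F], so this power of [kap] acts as a scalar. *)
  have : (kap ^+ (q ^ 2 - q + 1)) ^+ ((q + 1) * (q - 1)) = 1.
    by rewrite -exprM mulnA -q3 exprM (prim_expr_order pk) expr1n.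
  case/(prim_rootP plL)=> i Ei; exists (lam ^+ i).
  rewrite SX; have -> : A ^+ (q ^ 2 - q + 1) = (lam ^+ i)%:M.
    apply/row_matrixP=> l; rewrite !rowE -(r'K (delta_mx 0 l)) rAX Ei.
    by rewrite -[_%:A ^+ i](rmorphXn (in_alg L)) /= -scalerAr mulr1 linearZ /= mul_mx_scalar.
  by rewrite mul_mx_scalar -scalemxAl mulmxV // scalemx1.
- move=> x j c xn0 /andP[j0 jn]; apply/eqP; rewrite SX => E.
  have xP0 : x *m P != 0.
    by apply: contra xn0 => /eqP xP; rewrite -(mulmxK uP x) xP mul0mx.
  set y := r' (x *m P); have y0 : y != 0.
    by apply: contra xP0 => /eqP ry; rewrite -[x *m P]r'K -/y ry linear0.
  have Ey : y * kap ^+ j = c *: y.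
    apply: (can_inj rK); rewrite -rAX linearZ /= r'K.
    by rewrite scalemxAl -E !mulmxA mulmxKV.
  have {}Ey : kap ^+ j = c%:A.
    by apply: (mulfI y0); rewrite Ey -scalerAr mulr1.
  have c0 : c != 0.
    by have := expf_neq0 j kap0; rewrite Ey scaler_eq0 negb_or => /andP[].
  have cq : c ^+ ((q + 1) * (q - 1)) = 1.
    apply: (mulfI c0); rewrite -exprS mulr1 -(card_predE cardF) prednK ?expf_card //.
    by rewrite ltnW ?finNzRing_gt1.
  (* An eigenvector puts [kap ^+ j] into [F], whence this divisibility. As q^2 - q + 1 = q (q - 1) +
     1 is coprime to q - 1, it divides j. *)
  have : (q ^ 3 + 1 %| j * ((q + 1) * (q - 1)))%N.
    by rewrite (prim_order_dvd pk) exprM Ey -(rmorphXn (in_alg L)) cq rmorph1.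
  rewrite q3 [((q + 1) * _)%N]mulnC mulnA dvdn_pmul2r; last by rewrite addn1.
  rewrite Gauss_dvdl; last first.
    have -> : (q ^ 2 - q + 1 = q * (q - 1) + 1)%N by rewrite mulnBr muln1.
    by rewrite /coprime gcdnC gcdnMDl gcdn1.
  by move/(dvdn_leq j0); rewrite leqNgt jn.
Qed.
End Singer.

(** * Unitary groups acting on isotropic points *)

Lemma scalar_mx0 (R : pzRingType) n : 0%:M = 0 :> 'M[R]_n.
Proof. by apply/matrixP=> i j; rewrite !mxE mul0rn. Qed.

Lemma scalar_mx1_inj (R : pzRingType) (x y : R) : x%:M = y%:M :> 'M_1 -> x = y.
Proof. by move/matrixP/(_ 0 0); rewrite !mxE. Qed.

Section Stabiliser.

Variables (F : finFieldType) (n : nat).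
Implicit Types g h : {'GL_n.+1[F]}.

Definition gmx g : 'M[F]_n.+1 := GLval g.

Lemma gmx1 : gmx 1%g = 1%:M.
Proof. by rewrite /gmx GL_1E. Qed.

Lemma gmx_inj : injective gmx.
Proof. exact: val_inj. Qed.

Definition GL_mk (A : 'M[F]_n.+1) : {'GL_n.+1[F]} :=
  insubd (1%g : {'GL_n.+1[F]}) (A : 'M_n.+1.-1.+1).

Lemma gmx_GL_mk (A : 'M[F]_n.+1) : A \in unitmx -> gmx (GL_mk A) = A.
Proof.
by move=> uA; rewrite /gmx [LHS]val_insubd -[X in if X then _ else _]/(A \in unitmx) uA.
Qed.

Lemma GL_exists (A : 'M[F]_n.+1) : A \in unitmx -> exists g : {'GL_n.+1[F]}, gmx g = A.
Proof. by move=> uA; exists (GL_mk A); apply: gmx_GL_mk. Qed.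

Lemma gmx_unit g : gmx g \in unitmx.
Proof. exact: (valP g). Qed.

Lemma gmxM g h : gmx (g * h)%g = gmx g *m gmx h.
Proof. by rewrite /gmx GL_ME. Qed.

Definition stabmx m (G : {set {'GL_n.+1[F]}}) (V : 'M[F]_(m, n.+1)) :=
  [set g in G | (V *m gmx g <= V)%MS].

Lemma stabmx_group_set m (G : {group {'GL_n.+1[F]}}) (V : 'M_(m, n.+1)) :
  group_set (stabmx G V).
Proof.
apply/group_setP; split=> [|g h]; first by rewrite inE group1 gmx1 mulmx1 submx_refl.
rewrite !inE => /andP[Gg Vg] /andP[Gh Vh]; apply/andP; split; first exact: groupM.
rewrite gmxM mulmxA.
by rewrite (submx_trans (submxMr _ Vg)).
Qed.
Canonical stabmx_group m G V := Group (@stabmx_group_set m G V).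

Lemma stabmx_sub m (G : {set {'GL_n.+1[F]}}) (V : 'M_(m, n.+1)) : stabmx G V \subset G.
Proof. by apply/subsetP=> g; rewrite inE => /andP[]. Qed.

Lemma mulmx_gmxV m g (V : 'M_(m, n.+1)) : V *m gmx g *m gmx g^-1 = V.
Proof. by rewrite -mulmxA -gmxM mulgV gmx1 mulmx1. Qed.

Lemma mulmx_gmxVK m g (V : 'M_(m, n.+1)) : V *m gmx g^-1 *m gmx g = V.
Proof. by rewrite -mulmxA -gmxM mulVg gmx1 mulmx1. Qed.

Lemma gmxX g j : gmx (g ^+ j)%g = gmx g ^+ j.
Proof. by elim: j => [|j IHj]; rewrite ?expg0 ?expr0 ?gmx1 // expgS exprS gmxM IHj. Qed.

Lemma stabmx_index (G : {group {'GL_n.+1[F]}}) (v : 'rV_n.+1) : v != 0 ->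
  #|(fun g => <<v *m gmx g>>%MS) @: G| = #|G : stabmx G v|.
Proof.
move=> v0; apply: index_orbit; first exact: stabmx_sub.
move=> g h Gg Gh; have Ggh : (g * h^-1)%g \in G by rewrite groupM ?groupV.
rewrite inE Ggh andTb gmxM mulmxA.
have rk (x : {'GL_n.+1[F]}) : \rank (v *m gmx x) = 1%N.
  rewrite mxrankMfree; last by rewrite row_free_unit gmx_unit.
  by rewrite rank_rV v0.
apply/eqP/idP => [/genmxP/andP[vgh _]|le].
  by have := submxMr (gmx h^-1) vgh; rewrite mulmx_gmxV.
apply/genmxP; rewrite -(geq_leqif (mxrank_leqif_eq _)) ?rk //.
by have := submxMr (gmx h) le; rewrite mulmx_gmxVK.
Qed.

End Stabiliser.

(** * Hyperbolic pairs in the unitary 3-space *)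

Section GU3.

Variables (F : finFieldType) (q : nat) (theta : {rmorphism F -> F}).
Hypotheses (thetaE : forall x, theta x = x ^+ q) (oddq : odd q).
Hypotheses (q_gt2 : (2 < q)%N) (cardF : #|F| = (q ^ 2)%N) (two0 : 2%:R != 0 :> F).
Variable c : F.
Hypothesis cE : c * theta c = -1.
Local Notation adj := (adj theta).
Local Notation tK := (thetaK thetaE cardF).

(* [GU_set n] is the unitary group of dimension n + 1. *)
Definition GU_set n := [set g : {'GL_n.+1[F]} | gmx g *m adj (gmx g) == 1%:M].

Lemma GU_group_set n : group_set (GU_set n).
Proof.
apply/group_setP; split=> [|g h]; first by rewrite inE gmx1 adj1 mulmx1.
rewrite !inE gmxM adjM => /eqP Eg /eqP Eh.
by rewrite mulmxA -(mulmxA (gmx g)) Eh mulmx1 Eg.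
Qed.
Canonical GU_group n := Group (GU_group_set n).

Lemma GU_form n g m1 m2 (u : 'M_(m1, n.+1)) (v : 'M_(m2, n.+1)) : g \in GU_set n ->
  (u *m gmx g) *m adj (v *m gmx g) = u *m adj v.
Proof. by rewrite inE => /eqP Eg; rewrite adjM -mulmxA [gmx g *m _]mulmxA Eg mul1mx. Qed.

Lemma c_neq0 : c != 0.
Proof. by apply/eqP=> c0; move/eqP: cE; rewrite c0 mul0r eq_sym oppr_eq0 oner_eq0. Qed.

Definition rv3 (a b d : F) : 'rV_3 := \row_i [:: a; b; d]`_i.
Definition mx3 (u v w : 'rV[F]_3) : 'M_3 := \matrix_i [:: u; v; w]`_i.

Lemma rv3P (u : 'rV_3) : exists a b d, u = rv3 a b d.
Proof.
exists (u 0 0), (u 0 1), (u 0 ord_max); apply/rowP=> -[[|[|[|//]]] i3]; rewrite mxE /=;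
by congr (u 0 _); apply: val_inj.
Qed.

Lemma form3E a b d a' b' d' :
  rv3 a b d *m adj (rv3 a' b' d') = (a * theta a' + b * theta b' + d * theta d')%:M.
Proof.
apply/matrixP=> i j; rewrite !ord1 !mxE eqxx mulr1n !big_ord_recl big_ord0 !adjE !mxE /=.
by rewrite addr0 addrA.
Qed.

Lemma rv3Z x a b d : x *: rv3 a b d = rv3 (x * a) (x * b) (x * d).
Proof. by apply/rowP=> -[[|[|[|//]]] i3]; rewrite !mxE. Qed.

Lemma rv3_inj a b d a' b' d' : rv3 a b d = rv3 a' b' d' -> [/\ a = a', b = b' & d = d'].
Proof.
move=> E; split.
- by move/rowP/(_ 0): E; rewrite !mxE.
- by move/rowP/(_ 1): E; rewrite !mxE.
- by move/rowP/(_ ord_max): E; rewrite !mxE.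
Qed.

Lemma rv3_0 : 0 = rv3 0 0 0.
Proof. by apply/rowP=> -[[|[|[|//]]] i3]; rewrite !mxE. Qed.

(** With [pt_f] a hyperbolic pair: since [c] has norm -1, both vectors are isotropic, and their
    product is 2. *)
Definition pt_e := rv3 1 c 0.
Definition pt_f := rv3 1 (- c) 0.

Lemma pt_e_iso : pt_e *m adj pt_e = 0.
Proof. by rewrite form3E cE rmorph1 mulr1 subrr mul0r addr0 scalar_mx0. Qed.

Lemma pt_f_iso : pt_f *m adj pt_f = 0.
Proof. by rewrite form3E rmorphN mulrNN cE rmorph1 mulr1 subrr mul0r addr0 scalar_mx0. Qed.

Lemma pt_e_neq0 : pt_e != 0.
Proof. by apply/eqP; rewrite rv3_0 => /rv3_inj[/eqP]; rewrite oner_eq0. Qed.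

Lemma pt_f_neq0 : pt_f != 0.
Proof. by apply/eqP; rewrite rv3_0 => /rv3_inj[/eqP]; rewrite oner_eq0. Qed.

(** Independent orthogonal isotropic vectors would give a matrix of rank 2 with [A *m adj A = 0],
    which forces 2 + 2 <= 3. *)
Lemma iso_pair (u v : 'rV_3) :
  u != 0 -> u *m adj u = 0 -> v *m adj v = 0 -> ~~ (v <= u)%MS -> (u *m adj v) 0 0 != 0.
Proof.
move=> u0 uu vv nvu; apply/eqP=> uv0.
have uv : u *m adj v = 0 by rewrite [LHS]mx11_scalar uv0 scalar_mx0.
have vu : v *m adj u = 0 by rewrite -[v](adjK thetaE cardF) -adjM uv adj0.
pose A := col_mx u v; have AA : A *m adj A = 0.
  by rewrite /A adj_col mul_col_row uu uv vu vv block_mx0.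
have fA : row_free A.
  apply: inj_row_free => x; rewrite -[x]hsubmxK mul_row_col.
  set a := lsubmx x; set b := rsubmx x; rewrite (mx11_scalar a) (mx11_scalar b) !mul_scalar_mx.
  have [->|b0] := eqVneq (b 0 0) 0; last first.
    move/eqP; rewrite addrC addr_eq0 => /eqP E; case/negP: nvu.
    by rewrite -(scalerK b0 v) E -scaleNr !scalemx_sub.
  rewrite scale0r addr0 => /eqP; rewrite scaler_eq0 (negPf u0) orbF => /eqP->.
  by rewrite scalar_mx0 row_mx0.
have := mulmx0_rank_max AA; rewrite /adj mxrank_tr mxrank_map.
by move/eqP: fA => ->.
Qed.

Lemma cross_vec (u v : 'rV_3) : u *m adj u = 0 -> v *m adj v = 0 ->
  u *m adj v = 2%:M -> exists w : 'rV_3, [/\ w *m adj w = 1%:M, w *m adj u = 0 & w *m adj v = 0].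
Proof.
have [a0 [a1 [a2 ->]]] := rv3P u; have [b0 [b1 [b2 ->]]] := rv3P v.
rewrite !form3E -(scalar_mx0 _ 1) => /scalar_mx1_inj E1 /scalar_mx1_inj E2 /scalar_mx1_inj E3.
have E4 : b0 * theta a0 + b1 * theta a1 + b2 * theta a2 = 2.
  by rewrite -[RHS](rmorph_nat theta 2) -E3 !rmorphD !rmorphM /= !tK; ring.
pose w0 := a1 * b2 - a2 * b1; pose w1 := a2 * b0 - a0 * b2; pose w2 := a0 * b1 - a1 * b0.
(* The conjugate of the cross product u x v is orthogonal to u and v, and by
   Lagrange's identity its norm is - 2 * 2. *)
exists ((c / 2) *: rv3 (theta w0) (theta w1) (theta w2)).
rewrite rv3Z !form3E /w0 /w1 /w2 !(rmorphM, rmorphB) /= !tK; split; congr _%:M.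
- rewrite fmorphV rmorph_nat.
  transitivity (c * theta c / 4 * ((a0 * theta a0 + a1 * theta a1 + a2 * theta a2)
    * (b0 * theta b0 + b1 * theta b1 + b2 * theta b2)
    - (a0 * theta b0 + a1 * theta b1 + a2 * theta b2)
    * (b0 * theta a0 + b1 * theta a1 + b2 * theta a2))).
    by field; rewrite -[4]/((2 * 2)%:R) natrM mulf_neq0.
  rewrite E1 E2 E3 E4 cE mul0r sub0r; field.
  by rewrite -[4]/((2 * 2)%:R) natrM mulf_neq0.
- by ring.
- by ring.
Qed.

(** The Gram matrix of a frame (u, w, v), where u, v are isotropic with product 2 and w is a unit
    vector orthogonal to both. *)
Definition gramJ : 'M[F]_3 :=
  \matrix_(i, j) ((i + j == 2)%N%:R * (if (i == 1 :> nat)%N then 1 else 2%:R)).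

Lemma gramJ_unit : gramJ \in unitmx.
Proof.
pose J' : 'M[F]_3 := \matrix_(i, j) ((i + j == 2)%N%:R * (if (i == 1 :> nat)%N then 1 else 2%:R^-1)).
have : gramJ *m J' = 1%:M; last by case/mulmx1_unit.
apply/matrixP=> -[[|[|[|//]]] i3] -[[|[|[|//]]] j3];
  rewrite !mxE !big_ord_recl big_ord0 !mxE /= !(mul0r, mulr0, mul1r, addr0, add0r) ?divff //.
Qed.

Lemma frame_gram (u w v : 'rV_3) :
  u *m adj u = 0 -> v *m adj v = 0 -> u *m adj v = 2%:M ->
  w *m adj w = 1%:M -> w *m adj u = 0 -> w *m adj v = 0 ->
  mx3 u w v *m adj (mx3 u w v) = gramJ.
Proof.
move=> uu vv uv ww wu wv.
have uw : u *m adj w = 0 by rewrite -(adjK thetaE cardF u) -adjM wu adj0.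
have vw : v *m adj w = 0 by rewrite -(adjK thetaE cardF v) -adjM wv adj0.
have vu : v *m adj u = 2%:M.
  rewrite -(adjK thetaE cardF v) -adjM uv; apply/matrixP=> i j.
  by rewrite adjE !mxE !ord1 !eqxx rmorphMn rmorph_nat.
apply/matrixP=> i j; rewrite -{1}[mx3 u w v]mulmx1 form_entry mulmx1 !rowK.
case: i => -[|[|[|//]]] i3; case: j => -[|[|[|//]]] j3 /=;
  rewrite ?(uu, uw, uv, wu, ww, wv, vu, vw, vv) !mxE ?mul0r ?mul1r //.
Qed.

Lemma std_frame_gram (R0 := mx3 pt_e (rv3 0 0 1) pt_f) : R0 *m adj R0 = gramJ.
Proof.
have e3e : rv3 0 0 1 *m adj pt_e = 0.
  by rewrite form3E rmorph0 !mul0r mulr0 !addr0 scalar_mx0.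
have e3f : rv3 0 0 1 *m adj pt_f = 0.
  by rewrite form3E rmorph0 !mul0r mulr0 !addr0 scalar_mx0.
have e33 : rv3 0 0 1 *m adj (rv3 0 0 1) = 1%:M.
  by rewrite form3E rmorph0 rmorph1 !mul0r !add0r mulr1.
have ef : pt_e *m adj pt_f = 2%:M.
  by rewrite form3E rmorphN mulrN cE opprK rmorph1 rmorph0 mulr0 addr0 mulr1.
by apply: frame_gram; rewrite ?pt_e_iso ?pt_f_iso.
Qed.

(** Witt's theorem for hyperbolic pairs: after rescaling to product 2 and adding a unit vector, the
    frame has the same Gram matrix as the standard one. *)
Lemma trans2_iso (u v : 'rV_3) :
  u != 0 -> u *m adj u = 0 -> v *m adj v = 0 -> ~~ (v <= u)%MS ->
  exists2 t, t \in GU_set 2 &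
    (pt_e *m gmx t <= u)%MS /\ (pt_f *m gmx t <= v)%MS.
Proof.
move=> u0 uu vv nvu; have x0 := iso_pair u0 uu vv nvu; set x := (u *m _) 0 0 in x0.
(* The form conjugates scalars of its second argument, hence the [theta]. *)
pose mu := theta (2 / x); pose v' := mu *: v.
have vv' : v' *m adj v' = 0 by rewrite /v' adjZ -scalemxAl -scalemxAr vv !scaler0.
have uv' : u *m adj v' = 2%:M.
  rewrite /v' adjZ -scalemxAr [u *m _]mx11_scalar -/x /mu tK.
  by rewrite scale_scalar_mx divfK.
have [w [ww wu wv]] := cross_vec uu vv' uv'.
pose R0 := mx3 pt_e (rv3 0 0 1) pt_f; pose R := mx3 u w v'.
have GR0 : R0 *m adj R0 = gramJ by apply: std_frame_gram.
have GR : R *m adj R = gramJ by apply: frame_gram.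
have [uR0 uR UR] := frame_unitary gramJ_unit GR0 GR.
have [t tE] : exists t : {'GL_3[F]}, gmx t = invmx R0 *m R.
  by apply: GL_exists; rewrite unitmx_mul unitmx_inv uR0.
have rowE i : row i R0 *m gmx t = row i R.
  by rewrite tE !rowE -mulmxA mulKVmx.
exists t; first by rewrite inE tE UR.
have := rowE 0; have := rowE ord_max; rewrite !rowK /= => -> ->.
by split; rewrite ?submx_refl // scalemx_sub.
Qed.

End GU3.

Lemma mulmx_gmx_neq0 (F : finFieldType) n (g : {'GL_n.+1[F]}) (v : 'rV_n.+1) :
  v != 0 -> v *m gmx g != 0.
Proof. by apply: contraNneq => E; rewrite -(mulmx_gmxV g v) E mul0mx. Qed.

(** * The isotropic points of the 3-space *)

Section UnitalPoints.

Variables (F : finFieldType) (q : nat) (theta : {rmorphism F -> F}).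
Hypotheses (thetaE : forall x, theta x = x ^+ q) (oddq : odd q).
Hypotheses (q_gt2 : (2 < q)%N) (cardF : #|F| = (q ^ 2)%N) (two0 : 2%:R != 0 :> F).
Variable c : F.
Hypothesis cE : c * theta c = -1.
Local Notation adj := (adj theta).
Local Notation tK := (thetaK thetaE cardF).
Local Notation pt_e := (pt_e c).
Local Notation pt_f := (pt_f c).
Local Notation GU3 := (GU_group theta 2).

(** [trans2_iso] asks for a second point; [pt_f] or [pt_e] will do, as [u] cannot span both. *)
Lemma trans_iso (u : 'rV_3) : u != 0 -> u *m adj u = 0 ->
  exists2 t, t \in GU3 & (pt_e *m gmx t <= u)%MS.
Proof.
move=> u0 uu; have [fu|nfu] := boolP (pt_f <= u)%MS; last first.
  by have [t Gt [tu _]] := trans2_iso thetaE cardF two0 cE u0 uu (pt_f_iso cE) nfu; exists t.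
have neu : ~~ (pt_e <= u)%MS.
  apply/negP=> eu; have ef : (pt_e <= pt_f)%MS.
    by apply: submx_trans eu _; rewrite -(geq_leqif (mxrank_leqif_sup fu)) !rank_rV u0 pt_f_neq0.
  have /sub_rVP[a] := ef; rewrite rv3Z => /rv3_inj[E1 E2 _].
  have a1 : a = 1 by rewrite E1 mulr1.
  move: E2; rewrite a1 mul1r => /eqP; rewrite -subr_eq0 opprK -mulr2n -mulr_natl.
  by rewrite mulf_eq0 (negPf two0) (negPf (c_neq0 cE)).
by have [t Gt [tu _]] := trans2_iso thetaE cardF two0 cE u0 uu (pt_e_iso cE) neu; exists t.
Qed.

(* The isotropic points other than <pt_e> are the <upt (b, d)> with
   theta d = - d, each of them once. *)
Definition upt (x : F * F) : 'rV_3 :=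
  (x.2 - x.1 * theta x.1 / 4) *: pt_e + x.1 *: rv3 0 0 1 + pt_f.

Lemma uptE x (a := x.2 - x.1 * theta x.1 / 4) : upt x = rv3 (a + 1) (c * (a - 1)) x.1.
Proof. by apply/rowP=> -[[|[|[|//]]] i3]; rewrite /upt -/a !mxE /=; ring. Qed.

(** The vector a e + b w + f has norm 2 (a + theta a) + b theta b, which vanishes for a = d - b
    theta b / 4 with theta d = - d. *)
Lemma upt_iso x : theta x.2 = - x.2 -> upt x *m adj (upt x) = 0.
Proof.
case: x => b d /= td; rewrite uptE form3E -(scalar_mx0 _ 1); congr _%:M => /=.
rewrite !(rmorphM, rmorphD, rmorphN, rmorph1) /= fmorphV !rmorph_nat td tK.
set tb := theta b; set tc := theta c.
transitivity (2%:R * (d - b * tb / 4) + 2%:R * (- d - tb * b / 4) + b * tb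
   + (1 + c * tc) * (d - b * tb / 4 - 1) * (- d - tb * b / 4 - 1)).
  ring.
rewrite cE subrr mul0r mul0r addr0; field.
by rewrite -[4]/((2 * 2)%:R) natrM mulf_neq0.
Qed.

Lemma upt_inj x y k : upt x = k *: upt y -> x = y.
Proof.
case: x y => b d [b' d']; rewrite !uptE rv3Z /= => /rv3_inj[E1 E2 E3].
have c0 := c_neq0 cE.
move: E2; rewrite mulrCA => /(mulfI c0) E2.
have k1 : k = 1.
  apply: (mulfI two0); set A := (d - _) in E1 E2; set B := (d' - _) in E1 E2.
  by transitivity (k * (B + 1) - k * (B - 1)); [ring | rewrite -E1 -E2; ring].
move: E1 E3; rewrite k1 !mul1r => E1 E3; congr pair => //.
by move/addIr: E1; rewrite E3 => /addIr.
Qed.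

Lemma upt_neq0 x : upt x != 0.
Proof.
apply/eqP; rewrite uptE rv3_0 => /rv3_inj[E1 E2 _].
move/eqP: E2; rewrite mulf_eq0 (negPf (c_neq0 cE)) /= subr_eq0 => /eqP E2.
by move/eqP: E1; rewrite E2 -mulr2n (negPf two0).
Qed.

Lemma iso_upt (u : 'rV_3) : u != 0 -> u *m adj u = 0 ->
  (exists2 k, k != 0 & u = k *: pt_e) \/
  exists k x, [/\ k != 0, theta x.2 = - x.2 & u = k *: upt x].
Proof.
have [y0 [y1 [y2 ->]]] := rv3P u; move=> u0 /[dup] uu.
rewrite form3E -(scalar_mx0 _ 1) => /scalar_mx1_inj E.
have c0 := c_neq0 cE.
(* The equality says that the coordinate along [pt_f] is 0; isotropy then leaves a multiple of
   [pt_e]. *)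
have [y01|ne] := eqVneq y1 (c * y0).
  have y20 : y2 = 0.
    move: E; rewrite y01 rmorphM /= mulrACA cE mulN1r subrr add0r => /eqP.
    by rewrite mulf_eq0 fmorph_eq0 orbb => /eqP.
  left; exists y0; last by rewrite rv3Z mulr1 mulr0 y01 y20 mulrC.
  by apply: contraNneq u0 => y00; rewrite y01 y20 y00 mulr0 -rv3_0.
pose k := (y0 - y1 / c) / 2; have k0 : k != 0.
  rewrite mulf_neq0 ?invr_neq0 // subr_eq0; apply: contraNneq ne => ->.
  by rewrite mulrCA mulfV // mulr1.
(* The coordinates of [u] along [pt_e], the third basis vector and [pt_f] are k a, k b and k. *)
pose a := (y0 + y1 / c) / 2 / k; pose b := y2 / k.
right; exists k, (b, a + b * theta b / 4).
have uE : rv3 y0 y1 y2 = k *: upt (b, a + b * theta b / 4).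
  rewrite uptE /= rv3Z addrK /b [k * (y2 / k)]mulrC divfK //.
  have Ea : k * a = (y0 + y1 / c) / 2 by rewrite /a [k * _]mulrC divfK.
  rewrite mulrCA !(mulrDr k) mulrN mulr1 Ea /k; congr rv3; field; rewrite ?two0 ?c0 //.
split=> //=; clearbody a b.
have : upt (b, a + b * theta b / 4) *m adj (upt (b, a + b * theta b / 4)) = 0.
  move: uu; rewrite uE adjZ -scalemxAl -scalemxAr scalerA => /eqP.
  by rewrite scaler_eq0 mulf_eq0 fmorph_eq0 (negPf k0) => /eqP.
rewrite uptE form3E /= addrK -(scalar_mx0 _ 1) => /scalar_mx1_inj.
rewrite !(rmorphM, rmorphD, rmorphN, rmorph1) /= fmorphV !rmorph_nat tK.
set ta := theta a; set tb := theta b; set tc := theta c => E0.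
have : 2%:R * (a + ta) + b * tb + (1 + c * tc) * (a - 1) * (ta - 1) = 0.
  by rewrite -[RHS]E0; ring.
rewrite cE subrr !mul0r addr0 => E1.
apply/eqP; rewrite -subr_eq0 opprK; apply/eqP; apply: (mulfI two0).
rewrite mulr0 -[RHS]E1; field.
by rewrite -[4]/((2 * 2)%:R) natrM mulf_neq0.
Qed.

Lemma GU3_index : #|GU3 : stabmx GU3 pt_e| = (q ^ 3 + 1)%N.
Proof.
rewrite -stabmx_index ?pt_e_neq0 //.
pose D := setX [set: F] [set d : F | theta d == - d].
have -> : (fun g => <<pt_e *m gmx g>>%MS) @: GU3 =
    <<pt_e>>%MS |: [set <<upt x>>%MS | x in D].
  apply/setP=> V; apply/imsetP/setU1P => [[g Gg ->]|].
    have v0 : pt_e *m gmx g != 0 by rewrite mulmx_gmx_neq0 ?pt_e_neq0.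
    have vv : (pt_e *m gmx g) *m adj (pt_e *m gmx g) = 0 by rewrite GU_form // pt_e_iso.
    case: (iso_upt v0 vv) => [[k k0 ->]|[k [x [k0 tx ->]]]]; [left|right].
      exact/eq_genmx/eqmx_scale.
    apply/imsetP; exists x; first by rewrite !inE tx eqxx.
    exact/eq_genmx/eqmx_scale.
  have fin (u : 'rV_3) : u != 0 -> u *m adj u = 0 ->
      exists2 g, g \in GU3 & <<u>>%MS = <<pt_e *m gmx g>>%MS.
    move=> u0 uu; have [t Gt tu] := trans_iso u0 uu; exists t => //.
    apply/esym/genmxP; rewrite -(geq_leqif (mxrank_leqif_eq tu)).
    by rewrite mxrankMfree ?row_free_unit ?gmx_unit // !rank_rV u0 pt_e_neq0.
  case=> [->|/imsetP[x]]; first by apply: fin; rewrite ?pt_e_neq0 ?pt_e_iso.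
  rewrite !inE /= => /eqP tx ->; apply: fin; rewrite ?upt_neq0 ?upt_iso //.
have gen_eq (u v : 'rV[F]_3) : <<u>>%MS = <<v>>%MS -> exists k, u = k *: v.
  by move/genmxP/andP=> [/sub_rVP].
rewrite cardsU1 card_in_imset; last first.
  by move=> x y _ _ /gen_eq[k /upt_inj].
rewrite cardsX cardsT cardF (card_theta_neg thetaE oddq q_gt2 cardF two0).
have -> : <<pt_e>>%MS \notin [set <<upt x>>%MS | x in D].
  apply/imsetP=> -[x _ /gen_eq[k]]; rewrite uptE rv3Z => /rv3_inj[E1 E2 _].
  set a := (x.2 - _) in E1 E2.
  have E3 : 1 = k * (a - 1) by apply: (mulfI (c_neq0 cE)); rewrite mulr1 [LHS]E2 mulrCA.
  have k0 : k = 0.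
    apply: (mulfI two0); rewrite mulr0.
    by transitivity (k * (a + 1) - k * (a - 1)); [ring | rewrite -E1 -E3 subrr].
  by move/eqP: E1; rewrite k0 mul0r oner_eq0.
by rewrite add1n addn1 -expnSr.
Qed.

Lemma pt_swap : exists2 s, s \in GU3 & pt_e *m gmx s = pt_f.
Proof.
pose S : 'M[F]_3 := diag_mx (rv3 1 (-1) 1).
have SS : S *m adj S = 1%:M.
  rewrite /S; apply/matrixP=> i j; rewrite mul_diag_mx !mxE.
  by case: i => -[|[|[|//]]] i3; case: j => -[|[|[|//]]] j3;
    rewrite /= ?(mulr1n, mulr0n, rmorph0, rmorph1, rmorphN1, mulr0, mulr1, mulrNN).
have [s sE] := GL_exists (unitary_unit SS).
exists s; first by rewrite inE sE SS.
rewrite sE /S; apply/rowP=> j; rewrite mul_mx_diag !mxE.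
by case: j => -[|[|[|//]]] j3; rewrite /= ?(mulr1, mulrN1, mul0r).
Qed.

(** [tiling_pairs] in terms of isotropic points instead of cosets; the base pair is ([pt_e],
    [pt_f]). *)
Lemma GU3_tiling (a : {'GL_3[F]}) n l :
  prime l -> (0 < n)%N -> (q ^ 3 + 1 = 2 * l * n)%N -> a \in GU3 ->
  (forall u : 'rV_3, u != 0 -> u *m adj u = 0 ->
     forall j, (0 < j < n)%N -> ~~ (u *m gmx a ^+ j <= u)%MS) ->
  (forall u : 'rV_3, u *m adj u = 0 -> (u *m gmx a ^+ (2 * n) <= u)%MS) ->
  exists b, tiling GU3 (stabmx GU3 pt_e) b.
Proof.
move=> pl n0 qn Ga free triv; have [s Gs sE] := pt_swap.
have e0 (g : {'GL_3[F]}) : pt_e *m gmx g != 0 by rewrite mulmx_gmx_neq0 ?pt_e_neq0.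
have ee (g : {'GL_3[F]}) : g \in GU3 -> (pt_e *m gmx g) *m adj (pt_e *m gmx g) = 0.
  by move=> Gg; rewrite GU_form // pt_e_iso.
have back (g h : {'GL_3[F]}) (u : 'rV_3) :
    (u *m gmx g <= pt_e *m gmx h)%MS = (u *m gmx (g * h^-1)%g <= pt_e)%MS.
  rewrite gmxM mulmxA; apply/idP/idP => le.
    by have := submxMr (gmx h^-1) le; rewrite mulmx_gmxV.
  by have := submxMr (gmx h) le; rewrite mulmx_gmxVK.
apply: (@tiling_pairs _ GU3 (stabmx_group GU3 pt_e) s a n l) => //.
- exact: stabmx_sub.
- move=> g j Gg jn; apply/negP; rewrite inE => /andP[_].
  rewrite -back gmxM mulmxA gmxX; apply/negP/free => //; exact: ee.
- move=> g Gg; rewrite inE !groupM ?groupV ?groupX // andTb.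
  rewrite -back gmxM mulmxA gmxX; apply: triv; exact: ee.
- by rewrite GU3_index qn.
- move=> g1 g2 Gg1 Gg2 ng; have ng' : ~~ (pt_e *m gmx g2 <= pt_e *m gmx g1)%MS.
    apply: contra ng => le; rewrite inE groupM ?groupV // andTb -back.
    by rewrite -(geq_leqif (mxrank_leqif_sup le)) !rank_rV !e0.
  have [t Gt [t1 t2]] := trans2_iso thetaE cardF two0 cE (e0 g1) (ee _ Gg1) (ee _ Gg2) ng'.
  exists t; split=> //; rewrite inE !groupM ?groupV // andTb -back //.
  by rewrite gmxM mulmxA sE.
Qed.

End UnitalPoints.

(** * The two choices of the element of GU_3(q) *)

Section GU3Instances.

Variables (F : finFieldType) (p k q : nat) (theta : {rmorphism F -> F}).
Hypotheses (thetaE : forall x, theta x = x ^+ q) (oddq : odd q).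
Hypotheses (q_gt2 : (2 < q)%N) (cardF : #|F| = (q ^ 2)%N) (two0 : 2%:R != 0 :> F).
Hypotheses (pcharF : p \in [pchar F]) (qE : q = (p ^ k)%N).
Variable c : F.
Hypothesis cE : c * theta c = -1.
Local Notation adj := (adj theta).
Local Notation GU3 := (GU_group theta 2).

Lemma cubeD1 : (q ^ 3 + 1 = (q + 1) * (q ^ 2 - q + 1))%N.
Proof.
have : (q <= q ^ 2)%N by rewrite -{1}[q]expn1 leq_exp2l // (ltn_trans _ q_gt2).
by move=> le; rewrite addnBAC // mulnBr; lia.
Qed.

Lemma rv3_diag (x y z d0 d1 d2 : F) :
  rv3 x y z *m diag_mx (rv3 d0 d1 d2) = rv3 (x * d0) (y * d1) (z * d2).
Proof.
by apply/rowP=> j; rewrite mul_mx_diag !mxE; case: j => -[|[|[|//]]] j3.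
Qed.

Lemma rv3_diagX (x y z b : F) j :
  rv3 x y z *m diag_mx (rv3 1 b (b ^+ 2)) ^+ j = rv3 x (y * b ^+ j) (z * b ^+ (2 * j)).
Proof.
elim: j => [|j IHj]; first by rewrite !expr0 !mulr1 mulmx1.
rewrite exprSr -[_ * _]/(_ *m _) mulmxA IHj rv3_diag mulr1 -!mulrA -exprSr.
by rewrite -exprD; congr (rv3 _ _ (_ * _ ^+ _)); lia.
Qed.

(** For 0 < j < (q + 1) / 2 the eigenvalues 1, c1^j, c1^(2j) of the j-th power are distinct, so its
    eigenvectors are multiples of the basis vectors, none of them isotropic. The power q + 1 is the
    identity. *)
Lemma GU3_tiling_torus : prime (q ^ 2 - q + 1) ->
  exists b, tiling GU3 (stabmx GU3 (pt_e c)) b.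
Proof.
move=> pr; pose n := ((q + 1) %/ 2)%N.
have n2 : (2 * n = q + 1)%N by rewrite mulnC divnK // dvdn2 addn1 /= oddq.
have n0 : (0 < n)%N by lia.
have [c1 pc1] := prim_root_norm1 q_gt2 cardF.
have c1n : c1 * theta c1 = 1 by apply: (norm1_theta thetaE); apply: prim_expr_order.
pose A : 'M[F]_3 := diag_mx (rv3 1 c1 (c1 ^+ 2)).
have AA : A *m adj A = 1%:M.
  rewrite /A; apply/matrixP=> i j; rewrite mul_diag_mx !mxE.
  case: i => -[|[|[|//]]] i3; case: j => -[|[|[|//]]] j3;
    rewrite /= ?(mulr1n, mulr0n, rmorph0, rmorph1, mulr0, mulr1) //.
  by rewrite rmorphXn /= -exprMn c1n expr1n.
have [a aE] := GL_exists (unitary_unit AA).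
apply: (@GU3_tiling F q theta thetaE oddq q_gt2 cardF two0 c cE a n _ pr n0).
- by rewrite cubeD1 -n2; lia.
- by rewrite inE aE AA.
- move=> u; have [x [y [z ->]]] := rv3P u; move=> u0 uu j /andP[j0 jn].
  apply/negP=> /sub_rVP[m]; rewrite aE rv3_diagX rv3Z => /rv3_inj[E0 E1 E2].
  have b1 i : (0 < i < q + 1)%N -> c1 ^+ i != 1.
    move=> /andP[i0 iq]; rewrite -(prim_order_dvd pc1); apply/negP=> /(dvdn_leq i0).
    by rewrite leqNgt iq.
  have bj : c1 ^+ j != 1 by apply: b1; lia.
  have b2j : c1 ^+ (2 * j) != 1 by apply: b1; lia.
  have cj0 : c1 ^+ j != 0.
    rewrite expf_neq0 //; apply/eqP=> c0; move/eqP: c1n.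
    by rewrite c0 mul0r eq_sym oner_eq0.
  have bjj : c1 ^+ (2 * j) != c1 ^+ j.
    rewrite mul2n -addnn exprD; apply: contra bj => /eqP E.
    by apply/eqP/(mulfI cj0); rewrite E mulr1.
  have co (w d : F) : w * d = m * w -> w != 0 -> m = d.
    by move=> E w0; apply: (mulIf w0); rewrite -E mulrC.
  have nz (w : F) : w * theta w = 0 -> w = 0.
    by move/eqP; rewrite mulf_eq0 fmorph_eq0 orbb => /eqP.
  move: uu; rewrite form3E -(scalar_mx0 _ 1) => /scalar_mx1_inj.
  have [x0|x0] := eqVneq x 0; last first.
    have m1 : m = 1 by apply: (co x) => //; rewrite mulr1.
    have y0 : y = 0 by apply: contraNeq bj => /(co _ _ E1) <-; rewrite m1.
    have z0 : z = 0 by apply: contraNeq b2j => /(co _ _ E2) <-; rewrite m1.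
    by rewrite y0 z0 !mul0r !addr0 => /nz; apply/eqP.
  have [y0|y0] := eqVneq y 0.
    rewrite x0 y0 !mul0r !add0r => /nz z0.
    by move: u0; rewrite x0 y0 z0 -rv3_0 eqxx.
  have z0 : z = 0.
    by apply: contraNeq bjj => /(co _ _ E2) <-; rewrite (co _ _ E1 y0).
  by rewrite x0 z0 !mul0r addr0 add0r => /nz/eqP; apply/negP.
- move=> u _; have [x [y [z ->]]] := rv3P u; rewrite aE rv3_diagX n2.
  by rewrite [(2 * _)%N]mulnC exprM (prim_expr_order pc1) expr1n !mulr1 submx_refl.
Qed.

(** Here already the power n = q^2 - q + 1 is scalar, so all orbits have length n, and their number
    is q + 1 = 2 r. *)
Lemma GU3_tiling_singer r : prime r -> (q + 1 = 2 * r)%N ->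
  exists b, tiling GU3 (stabmx GU3 (pt_e c)) b.
Proof.
move=> pr qr.
have [S [SS [d Sd] Sfree]] := singer_cycle thetaE oddq q_gt2 cardF two0 pcharF qE.
have [a aE] := GL_exists (unitary_unit SS).
have n0 : (0 < q ^ 2 - q + 1)%N by rewrite addn1.
apply: (@GU3_tiling F q theta thetaE oddq q_gt2 cardF two0 c cE a _ _ pr n0).
- by rewrite cubeD1 qr.
- by rewrite inE aE SS.
- move=> u u0 _ j jn; apply/negP=> /sub_rVP[m]; rewrite aE => /eqP.
  by apply/negP/Sfree.
- move=> u _; rewrite aE mulnC exprM Sd -[_%:M ^+ 2]/(_ *m _).
  by rewrite mulmxA !mul_mx_scalar !scalemx_sub.
Qed.

End GU3Instances.

(** * The projective line *)

Lemma tiling_cover (gT : finGroupType) (G H : {group gT}) s :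
  prime_blocks G s -> (G \subset H * \prod_(x <- s) x.1)%g ->
  (#|H| * \prod_(x <- s) x.2 <= #|G|)%N -> tiling G H s.
Proof.
move=> Bs cov le; split=> //; apply/eqP; rewrite eqn_leq le /=.
have /andP[_ le'] := prime_blocks_prodn Bs.
apply: leq_trans (subset_leq_card cov) _; apply: leq_trans (leq_mul (leqnn _) le').
by have := card_set_prod ((H : {set gT}, 0%N) :: s); rewrite !big_cons.
Qed.

Section SL2.

Variables (F : finFieldType) (n : F).
Hypothesis nonsq : forall x, x ^+ 2 != n.
Hypothesis sq : forall m : F, m != 0 -> exists2 y, y != 0 & m = y ^+ 2 \/ m = - n * y ^+ 2.
Hypothesis two0 : 2%:R != 0 :> F.

Definition rv2 (a b : F) : 'rV_2 := \row_i [:: a; b]`_i.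
Definition mx2 (a b d e : F) : 'M_2 := \matrix_(i, j) (nth [::] [:: [:: a; b]; [:: d; e]] i)`_j.

Lemma rv2P (u : 'rV_2) : u = rv2 (u 0 0) (u 0 1).
Proof. by apply/rowP=> -[[|[|//]] i2]; rewrite mxE /=; congr (u 0 _); apply: val_inj. Qed.

Lemma mx2P (A : 'M_2) : A = mx2 (A 0 0) (A 0 1) (A 1 0) (A 1 1).
Proof.
by apply/matrixP=> -[[|[|//]] i2] -[[|[|//]] j2]; rewrite mxE /=; congr (A _ _); apply: val_inj.
Qed.

Lemma rv2M x y a b d e : rv2 x y *m mx2 a b d e = rv2 (x * a + y * d) (x * b + y * e).
Proof.
by apply/rowP=> -[[|[|//]] i2]; rewrite !mxE !big_ord_recl big_ord0 !mxE /= addr0.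
Qed.

Lemma mx2M a b d e a' b' d' e' : mx2 a b d e *m mx2 a' b' d' e' =
  mx2 (a * a' + b * d') (a * b' + b * e') (d * a' + e * d') (d * b' + e * e').
Proof.
by apply/matrixP=> -[[|[|//]] i2] -[[|[|//]] j2]; rewrite !mxE !big_ord_recl big_ord0 !mxE /= addr0.
Qed.

Lemma mx2_det a b d e : \det (mx2 a b d e) = a * e - b * d.
Proof.
rewrite (expand_det_row _ 0) !big_ord_recl big_ord0 /cofactor !det_mx11 !mxE /=.
by rewrite expr0 expr1 addr0 mul1r mulN1r mulrN.
Qed.

Lemma rv2_inj a b a' b' : rv2 a b = rv2 a' b' -> a = a' /\ b = b'.
Proof.
move=> E; split.
- by move/rowP/(_ 0): E; rewrite !mxE.
- by move/rowP/(_ 1): E; rewrite !mxE.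
Qed.

Lemma mx2_inj a b d e a' b' d' e' : mx2 a b d e = mx2 a' b' d' e' ->
  [/\ a = a', b = b', d = d' & e = e'].
Proof.
move=> E; split.
- by move/matrixP/(_ 0 0): E; rewrite !mxE.
- by move/matrixP/(_ 0 1): E; rewrite !mxE.
- by move/matrixP/(_ 1 0): E; rewrite !mxE.
- by move/matrixP/(_ 1 1): E; rewrite !mxE.
Qed.

Lemma rv2Z x a b : x *: rv2 a b = rv2 (x * a) (x * b).
Proof. by apply/rowP=> -[[|[|//]] i2]; rewrite !mxE. Qed.

Definition SL2_set := [set g : {'GL_2[F]} | \det (gmx g) == 1].

Lemma SL2_group_set : group_set SL2_set.
Proof.
apply/group_setP; split=> [|g h]; first by rewrite inE gmx1 det1.
by rewrite !inE gmxM det_mulmx => /eqP-> /eqP->; rewrite mulr1.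
Qed.
Canonical SL2 := Group SL2_group_set.

Lemma SL2_exists a b d e : a * e - b * d = 1 ->
  exists2 g, g \in SL2 & gmx g = mx2 a b d e.
Proof.
move=> E; have u : mx2 a b d e \in unitmx by rewrite unitmxE mx2_det E unitr1.
by have [g gE] := GL_exists u; exists g; rewrite ?inE gE ?mx2_det ?E.
Qed.

(** The nonsplit torus of the elements a + b sqrt n of norm 1, written as a centraliser. *)
Definition torus_set := [set g in SL2 | gmx g *m mx2 0 1 n 0 == mx2 0 1 n 0 *m gmx g].

Lemma torus_group_set : group_set torus_set.
Proof.
apply/group_setP; split=> [|g h]; first by rewrite inE group1 gmx1 mul1mx mulmx1 eqxx.
rewrite !(inE, in_setI) => /andP[Gg /eqP Eg] /andP[Gh /eqP Eh].
have Ggh : (g * h)%g \in SL2 by rewrite groupM ?inE.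
move: Ggh; rewrite inE => ->; rewrite andTb gmxM -mulmxA Eh mulmxA Eg mulmxA //.
Qed.
Canonical torus := Group torus_group_set.

Lemma torusP g : reflect (exists a b, a ^+ 2 - n * b ^+ 2 = 1 /\ gmx g = mx2 a b (n * b) a)
  (g \in torus).
Proof.
apply: (iffP idP).
  rewrite !inE => /andP[/eqP dg /eqP]; move: dg; rewrite (mx2P (gmx g)).
  move: (gmx g 0 0) (gmx g 0 1) (gmx g 1 0) (gmx g 1 1) => a b d e.
  rewrite mx2_det !mx2M => dg /mx2_inj[E1 E2 _ _]; exists a, b.
  have Ed : d = n * b by move: E1; rewrite !mulr0 !mul0r mul1r add0r add0r => <-; rewrite mulrC.
  have Ee : e = a by move: E2; rewrite !mulr0 !mul0r mul1r mulr1 addr0 add0r.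
  by split; rewrite ?Ed ?Ee //; rewrite -dg Ed Ee; ring.
case=> a [b [E gE]]; rewrite !inE gE mx2_det !mx2M; apply/andP; split.
  by apply/eqP; rewrite -E; ring.
by apply/eqP; congr mx2; ring.
Qed.

Lemma torus_sub : torus \subset SL2.
Proof. by apply/subsetP=> g; rewrite inE => /andP[]. Qed.

Lemma torus_abelian : abelian torus.
Proof.
apply/centsP=> g /torusP[a [b [_ gE]]] h /torusP[a' [b' [_ hE]]].
by apply: gmx_inj; rewrite !gmxM gE hE !mx2M; congr mx2; ring.
Qed.

(** Stereographic projection of the conic a^2 - n b^2 = 1 from (-1, 0): the slope determines the
    point, and [None] stands for the centre of projection. *)
Lemma torus_card : (#|torus| <= #|F| + 1)%N.
Proof.
pose f (g : {'GL_2[F]}) := let A := gmx g in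
  if A 0 0 == -1 then None else Some (A 0 1 / (A 0 0 + 1)).
have <- : #|{: option F}| = (#|F| + 1)%N by rewrite card_option addn1.
rewrite -cardsT -(card_in_imset (f := f)); first exact: subset_leq_card (subsetT _).
move=> g h /torusP[a [b [E gE]]] /torusP[a' [b' [E' hE]]]; rewrite /f gE hE !mxE /=.
have n0 : n != 0 by apply: contraNneq (nonsq 0) => ->; rewrite expr0n.
have bz (x y : F) : x ^+ 2 - n * y ^+ 2 = 1 -> x = -1 -> y = 0.
  move=> Exy x1; move: Exy; rewrite x1 sqrrN expr1n => /eqP.
  rewrite -[X in _ == X]addr0 (inj_eq (addrI _)) oppr_eq0 mulf_eq0 (negPf n0) /=.
  by rewrite sqrf_eq0 => /eqP.
have [a1|a1] := eqVneq a (-1); have [a1'|a1'] := eqVneq a' (-1) => //.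
  by move=> _; apply: gmx_inj; rewrite gE hE (bz _ _ E a1) (bz _ _ E' a1') a1 a1'.
case; set s := b / _ => Es; have d0 : a + 1 != 0 by rewrite addr_eq0.
have d0' : a' + 1 != 0 by rewrite addr_eq0.
have Eb : b = s * (a + 1) by rewrite /s divfK.
have Eb' : b' = s * (a' + 1) by rewrite Es divfK.
have lin (x y : F) : x ^+ 2 - n * y ^+ 2 = 1 -> x + 1 != 0 -> y = s * (x + 1) ->
    x * (1 - n * s ^+ 2) = 1 + n * s ^+ 2.
  move=> Exy x0 Ey; apply: (mulfI x0); apply/eqP; rewrite -subr_eq0; apply/eqP.
  transitivity (x ^+ 2 - n * y ^+ 2 - 1); last by rewrite Exy subrr.
  by rewrite Ey; ring.
have ns : 1 - n * s ^+ 2 != 0.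
  rewrite subr_eq0; have [->|s0] := eqVneq s 0; first by rewrite expr0n mulr0 oner_eq0.
  apply: contraNneq (nonsq s^-1) => Ens; apply/eqP.
  by rewrite exprVn -[LHS]mul1r Ens mulfK // expf_neq0.
have Ea : a = a'.
  by apply: (mulIf ns); rewrite (lin _ _ E d0 Eb) (lin _ _ E' d0' Eb').
by apply: gmx_inj; rewrite gE hE Eb Eb' Ea.
Qed.

Definition line2 := rv2 1 0.

Lemma line2_neq0 : line2 != 0.
Proof.
by apply/eqP=> /rowP/(_ 0)/eqP; rewrite !mxE /= oner_eq0.
Qed.

Lemma SL2_index : (#|F| + 1 <= #|SL2 : stabmx SL2 line2|)%N.
Proof.
rewrite -stabmx_index ?line2_neq0 //.
pose f (y : option F) := if y is Some z then <<rv2 1 z>>%MS else <<rv2 0 1>>%MS.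
have <- : #|{: option F}| = (#|F| + 1)%N by rewrite card_option addn1.
rewrite -cardsT -(card_imset (f := f)); last first.
  have gen_eq (u v : 'rV[F]_2) : <<u>>%MS = <<v>>%MS -> exists k, u = k *: v.
    by move/genmxP/andP=> [/sub_rVP].
  case=> [y|] [y'|] //= /gen_eq[k]; rewrite rv2Z => /rv2_inj[E1 E2].
  - by move: E2; rewrite -[k]mulr1 -E1 mul1r => ->.
  - by move/eqP: E1; rewrite mulr0 oner_eq0.
  - by move/eqP: E1; rewrite mulr1 eq_sym => /eqP k0; move/eqP: E2; rewrite k0 mul0r oner_eq0.
apply: subset_leq_card; apply/subsetP=> _ /imsetP[y _ ->].
case: y => [y|] /=.
  have [|g Gg gE] := @SL2_exists 1 y 0 1; first by rewrite mulr0 subr0 mulr1.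
  by apply/imsetP; exists g => //; rewrite gE rv2M !mul1r !mul0r !addr0.
have [|g Gg gE] := @SL2_exists 0 1 (-1) 0; first by rewrite mulr0 sub0r mulrN1 opprK.
by apply/imsetP; exists g => //; rewrite gE rv2M !mul1r !mul0r !addr0.
Qed.

(* A nonzero row (x, y) has norm x^2 - n y^2 either a square or -n times a
   square; the torus {a^2 - n b^2 = 1} has one orbit of points of each kind,
   those of (1, 0) and (0, 1). *)
Lemma SL2_tiling : exists s, tiling SL2 (stabmx SL2 line2) s.
Proof.
have n0 : n != 0 by apply: contraNneq (nonsq 0) => ->; rewrite expr0n.
(* This intersection consists of 1 and -1. *)
pose K := (torus :&: stabmx_group SL2 line2)%G.
have nK : K <| torus by rewrite /normal subsetIl (sub_abelian_norm torus_abelian) ?subsetIl.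
have [s ts] := tiling_sol_quotient nK (abelian_sol (quotient_abelian _ torus_abelian)).
case: ts => Bs covE cardE.
(* [t] maps (1, 0) to (0, 1), the representative of the second orbit of the torus. *)
have [|t Gt tE] := @SL2_exists 0 1 (-1) 0; first by rewrite mulr0 sub0r mulrN1 opprK.
exists (([set 1%g; t], 2%N) :: s); apply: tiling_cover.
- move=> x; rewrite inE => /predU1P[->|xs] /=.
    by split=> //; rewrite ?subUset ?sub1set ?group1 // cards2; case: (_ != _).
  by have [sx ? ?] := Bs x xs; split=> //; apply: subset_trans sx torus_sub.
- apply/subsetP=> g Gg; rewrite big_cons /=.
  have [u [ep [uT Tep Hg]]] : exists u ep, [/\ u \in [set 1%g; t], ep \in torus &
      (line2 *m gmx g <= line2 *m gmx u *m gmx ep)%MS].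
    have v0 := mulmx_gmx_neq0 g line2_neq0.
    move: v0; rewrite (rv2P (line2 *m gmx g)); move: (_ 0 0) (_ 0 1) => x y v0.
    have m0 : x ^+ 2 - n * y ^+ 2 != 0.
      rewrite subr_eq0; apply/eqP=> E; have [y0|y0] := eqVneq y 0.
        move/eqP: E; rewrite y0 expr0n mulr0 sqrf_eq0 => /eqP x0; move/eqP: v0; apply.
        by rewrite x0 y0; apply/rowP=> -[[|[|//]] i2]; rewrite !mxE.
      have := nonsq (x / y); rewrite expr_div_n E mulfK ?eqxx //.
      by rewrite expf_neq0.
    have [w w0 [E|E]] := sq m0.
      have [|ep Gep epE] := @SL2_exists (x / w) (y / w) (n * (y / w)) (x / w).
        by apply: (mulfI (expf_neq0 2 w0)); rewrite mulr1 -[RHS]E; field.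
      exists 1%g, ep; split; first by rewrite !inE eqxx.
        apply/torusP; exists (x / w), (y / w); split=> //.
        by apply: (mulfI (expf_neq0 2 w0)); rewrite mulr1 -[RHS]E; field.
      rewrite gmx1 mulmx1 epE rv2M !mul1r !mul0r !addr0; apply/sub_rVP.
      by exists w; rewrite rv2Z ![w * _]mulrC !divfK.
    have nw0 : - n * w ^+ 2 != 0 by rewrite mulf_neq0 ?oppr_eq0 ?expf_neq0.
    have [|ep Gep epE] := @SL2_exists (y / w) (x / (n * w)) (n * (x / (n * w))) (y / w).
      by apply: (mulfI nw0); rewrite mulr1 -[RHS]E; field; rewrite n0 w0.
    exists t, ep; split; first by rewrite !inE eqxx orbT.
      apply/torusP; exists (y / w), (x / (n * w)); split=> //.
      by apply: (mulfI nw0); rewrite mulr1 -[RHS]E; field; rewrite n0 w0.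
    rewrite tE epE !rv2M; apply/sub_rVP; exists w; rewrite rv2Z.
    by congr rv2; field; rewrite ?n0 ?w0.
  have : ep \in (K * \prod_(x <- s) x.1)%g by apply: (subsetP covE).
  case/mulsgP=> ka pi Kka ppi epE.
  (* [ka] is scalar, so it can pass to the left of [u] and be absorbed by the stabiliser. *)
  have cku : (u * ka = ka * u)%g.
    move: Kka; rewrite inE => /andP[/torusP[a [b [_ kaE]]]]; rewrite inE => /andP[_].
    rewrite kaE rv2M !mul1r !mul0r !addr0 => /sub_rVP[m]; rewrite rv2Z mulr1 mulr0.
    case/rv2_inj=> _ b0; apply: gmx_inj; rewrite !gmxM kaE b0 (mx2P (gmx u)) !mx2M.
    by congr mx2; ring.
  pose h := (g * ep^-1 * u^-1)%g.
  have Su : u \in SL2 by case/set2P: uT => ->; rewrite ?group1.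
  have Sep : ep \in SL2 by apply: (subsetP torus_sub).
  have Hh : h \in stabmx SL2 line2.
    rewrite inE !groupM ?groupV // andTb /h !gmxM !mulmxA.
    have := submxMr (gmx u^-1) (submxMr (gmx ep^-1) Hg); rewrite !mulmx_gmxV //.
  have -> : g = ((h * ka) * (u * pi))%g.
    by rewrite mulgA -[(h * ka * u)%g]mulgA -cku mulgA /h mulgKV -mulgA -epE mulgKV.
  apply: mem_mulg; last exact: mem_mulg.
  by rewrite (groupM (G := stabmx_group SL2 line2)) //; case/setIP: Kka.
(* As [K] contains -1, the factor 2 is at most its order; the product is thus bounded by the order
   of the torus, hence by the number of points. *)
- rewrite big_cons /= -(Lagrange (stabmx_sub SL2 line2)) leq_mul2l; apply/orP; right.
  apply: leq_trans SL2_index; apply: leq_trans torus_card; rewrite -cardE leq_mul2r.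
  apply/orP; right; have [|m Gm mE] := @SL2_exists (-1) 0 0 (-1).
    by rewrite mulrNN mulr1 mulr0 subr0.
  have c2 : #|[set 1%g; m]| = 2%N.
    rewrite cards2; case: eqP => // /(congr1 (@gmx _ _)); rewrite gmx1 mE.
    move/matrixP/(_ 0 0); rewrite !mxE /= => /eqP; rewrite -subr_eq0 opprK -mulr2n.
    by rewrite (negPf two0).
  apply: (@leq_trans #|[set 1%g; m]|); first by rewrite c2.
  apply: subset_leq_card; rewrite subUset !sub1set group1 /=; apply/setIP; split.
    by apply/torusP; exists (-1), 0; rewrite mE sqrrN expr1n expr0n !mulr0 subr0.
  by rewrite inE Gm mE rv2M !mul1r !mul0r !addr0 -(mulr0 (-1)) -{1}(mulr1 (-1)) -rv2Z scalemx_sub.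
Qed.

End SL2.

(** * Triangular groups *)

Section Triangular.

Variables (F : finFieldType) (n p : nat).
Hypothesis pcharF : p \in [pchar F].
Implicit Types A B : 'M[F]_n.+1.

Lemma trig_mul_diag A B i : is_trig_mx A -> is_trig_mx B -> (A *m B) i i = A i i * B i i.
Proof.
move=> /is_trig_mxP tA /is_trig_mxP tB; rewrite mxE (bigD1 i) //= big1 ?addr0 // => j ji.
have [lt|gt|E] := ltngtP i j; first by rewrite tA // mul0r.
  by rewrite tB // mulr0.
by move: ji; rewrite (val_inj E) eqxx.
Qed.

(** A - 1 is nilpotent by Cayley-Hamilton, and p^m-th powers are additive on the commuting matrices
    1 and A - 1. *)
Lemma unitrig_expn A : is_trig_mx A -> (forall i, A i i = 1) -> A ^+ (p ^ n.+1) = 1.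
Proof.
move=> tA dA; have pM : p \in [pchar 'M[F]_n.+1] by rewrite pchar_lalg.
have nil : (A - 1) ^+ n.+1 = 0.
  have := Cayley_Hamilton A; rewrite char_poly_trig // (eq_bigr (fun _ => 'X - 1%:P)).
    by rewrite prodr_const card_ord rmorphXn rmorphB /= horner_mx_X horner_mx_C.
  by move=> i _; rewrite dA.
have frob m : A ^+ (p ^ m) = 1 + (A - 1) ^+ (p ^ m).
  elim: m => [|m IHm]; first by rewrite expn0 !expr1 addrC subrK.
  rewrite expnSr !exprM IHm -!(pFrobenius_autE pM) pFrobenius_autD_comm ?pFrobenius_aut1 //.
  exact/commr_sym/commr1.
rewrite frob.
have p_pr := pcharf_prime pcharF.
have le : (n.+1 <= p ^ n.+1)%N by rewrite ltnW // ltn_expl // prime_gt1.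
by rewrite -(subnK le) exprD nil mulr0 addr0.
Qed.

(** The diagonal of the triangular form is multiplicative with commuting values. Its kernel contains
    the derived subgroup and has p-power exponent, so it is a p-group. *)
Lemma trig_solvable (G : {group {'GL_n.+1[F]}}) (T : 'M[F]_n.+1) : T \in unitmx ->
  (forall g, g \in G -> is_trig_mx (T *m gmx g *m invmx T)) -> solvable G.
Proof.
move=> uT tG; pose X (g : {'GL_n.+1[F]}) := T *m gmx g *m invmx T.
have XM g h : X (g * h)%g = X g *m X h by rewrite /X gmxM !mulmxA mulmxKV.
have X1 : X 1%g = 1%:M by rewrite /X gmx1 mulmx1 mulmxV.
have X_inj : injective X.
  move=> g h E; apply: gmx_inj.
  have : T *m gmx g = T *m gmx h by rewrite -(mulmxKV uT (T *m gmx g)) -/(X g) E /X mulmxKV.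
  by move=> E'; rewrite -(mulKmx uT (gmx g)) E' mulKmx.
have XX g j : X (g ^+ j)%g = X g ^+ j.
  by elim: j => [|j IHj]; rewrite ?expg0 ?expr0 // expgS exprS XM IHj.
have dM g h i : g \in G -> h \in G -> X (g * h)%g i i = X g i i * X h i i.
  by move=> Gg Gh; rewrite XM trig_mul_diag ?tG.
pose U := [set g in G | [forall i, X g i i == 1]].
have Ug : group_set U.
  apply/group_setP; split=> [|g h].
    by rewrite inE group1; apply/forallP=> i; rewrite X1 mxE eqxx.
  rewrite !inE => /andP[Gg /forallP dg] /andP[Gh /forallP dh]; rewrite groupM //.
  by apply/forallP=> i; rewrite dM // (eqP (dg i)) (eqP (dh i)) mulr1.
have sUG : Group Ug \subset G by apply/subsetP=> g; rewrite inE => /andP[].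
have der : (G^`(1) \subset Group Ug)%g.
  rewrite derg1 gen_subG; apply/subsetP=> _ /imset2P[g h Gg Gh ->].
  rewrite inE !groupR //; apply/forallP=> i.
  rewrite /commg /conjg !dM ?groupM ?groupV //.
  have dV x : x \in G -> X x^-1%g i i * X x i i = 1.
    by move=> Gx; rewrite -dM ?groupV // mulVg X1 mxE eqxx.
  apply/eqP; transitivity ((X g^-1%g i i * X g i i) * (X h^-1%g i i * X h i i)); first by ring.
  by rewrite !dV // mulr1.
have nU := sub_der1_normal der sUG.
rewrite (series_sol nU) (abelian_sol (sub_der1_abelian der)) andbT.
apply: (@pgroup_sol _ p); rewrite -pnat_exponent.
have p_pr := pcharf_prime pcharF.
have Em : (exponent (Group Ug) %| p ^ n.+1)%N.
  apply/exponentP=> u; rewrite inE => /andP[Gu /forallP du].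
  apply: X_inj; rewrite XX X1.
  exact: unitrig_expn (tG u Gu) (fun i => eqP (du i)).
by apply: pnat_dvd Em _; rewrite pnatX pnat_id ?orbT.
Qed.

End Triangular.

Section TorusParameter.

Variables (F : finFieldType) (q : nat) (theta : {rmorphism F -> F}).
Hypotheses (thetaE : forall x, theta x = x ^+ q).
Hypotheses (q_gt2 : (2 < q)%N) (cardF : #|F| = (q ^ 2)%N).

(** The inequalities separate the primitive element [lam] from the other eigenvalues 1, (theta
    lam)^-1 and theta lam / lam of the element of SU_4(q) built from it through [homology] and
    [psi]. *)
Lemma torus_parameter : exists lam : F,
  [/\ lam != 0, (q + 1).-primitive_root (theta lam / lam) &
     [/\ lam != 1, lam * theta lam != 1 & theta lam != lam ^+ 2]].
Proof.
have [lam pl] := prim_root_q2 cardF; exists lam.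
have ne i : (0 < i < (q + 1) * (q - 1))%N -> lam ^+ i != 1.
  move=> /andP[i0 iq]; rewrite -(prim_order_dvd pl); apply/negP=> /(dvdn_leq i0).
  by rewrite leqNgt iq.
have q2 : (2 * (q + 1) <= (q + 1) * (q - 1))%N by rewrite mulnC leq_mul2l; lia.
have l0 : lam != 0.
  apply/eqP=> E; have := prim_expr_order pl; rewrite E expr0n.
  by rewrite gtn_eqF; [move/esym/eqP; rewrite oner_eq0 | lia].
have tl : theta lam / lam = lam ^+ (q - 1).
  by rewrite thetaE -{1}(subnK (_ : 1 <= q)%N) ?addn1 ?exprSr ?mulfK //; lia.
split=> //.
  rewrite tl; have := exp_prim_root pl (q - 1).
  by rewrite gcdnMl mulnK // subn_gt0 (ltn_trans _ q_gt2).
rewrite thetaE; split; first by rewrite -[lam]expr1 ne //; lia.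
  by rewrite -exprS ne //; lia.
have -> : lam ^+ q = lam ^+ 2 * lam ^+ (q - 2) by rewrite -exprD; congr (_ ^+ _); lia.
rewrite -subr_eq0 -[X in _ - X]mulr1 -mulrBr mulf_neq0 ?expf_neq0 // subr_eq0 ne //; lia.
Qed.

End TorusParameter.

(** * Totally isotropic lines *)

Lemma adj_row (F : finFieldType) (theta : {rmorphism F -> F}) m n1 n2
    (A : 'M[F]_(m, n1)) (B : 'M[F]_(m, n2)) :
  adj theta (row_mx A B) = col_mx (adj theta A) (adj theta B).
Proof. by rewrite /adj map_row_mx tr_row_mx. Qed.

Lemma adj_scalar (F : finFieldType) (theta : {rmorphism F -> F}) n (a : F) :
  adj theta (a%:M : 'M_n) = (theta a)%:M.
Proof. by rewrite /adj map_scalar_mx tr_scalar_mx. Qed.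

Section SU4Lines.

Variables (F : finFieldType) (q : nat) (theta : {rmorphism F -> F}).
Hypotheses (thetaE : forall x, theta x = x ^+ q) (oddq : odd q).
Hypotheses (q_gt2 : (2 < q)%N) (cardF : #|F| = (q ^ 2)%N) (two0 : 2%:R != 0 :> F).
Variable c : F.
Hypothesis cE : c * theta c = -1.
Local Notation adj := (adj theta).
Local Notation tK := (thetaK thetaE cardF).
Local Notation pt_e := (pt_e c).
Local Notation pt_f := (pt_f c).
Local Notation GU3 := (GU_group theta 2).
Local Notation c0 := (c_neq0 cE).

Definition SU_set := [set g in GU_set theta 3 | \det (gmx g) == 1].

Lemma SU_group_set : group_set SU_set.
Proof.
apply/group_setP; split=> [|g h]; first by rewrite inE group1 gmx1 det1 eqxx.
move=> /setIdP[Gg /eqP dg] /setIdP[Gh /eqP dh]; apply/setIdP; split.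
  exact: (groupM (G := GU_group theta 3)).
by rewrite gmxM det_mulmx dg dh mulr1.
Qed.
Canonical SU := Group SU_group_set.

Lemma SU_sub_GU g : g \in SU -> g \in GU_set theta 3.
Proof. by rewrite inE => /andP[]. Qed.

Lemma SUE : SU4_set F q = SU.
Proof.
apply/setP=> g; rewrite !inE andbC; congr (_ && _).
by rewrite /gmx /adj (eq_map_mx _ thetaE).
Qed.

Definition vec4 a b d e : 'rV[F]_4 := row_mx (rv3 a b d) (e%:M : 'M_1).

Lemma vec4P (v : 'rV_4) : exists a b d e, v = vec4 a b d e.
Proof.
have : v = row_mx (lsubmx (v : 'rV_(3 + 1))) (rsubmx (v : 'rV_(3 + 1))) by rewrite hsubmxK.
have [a [b [d ->]]] := rv3P (lsubmx (v : 'rV_(3 + 1))).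
by rewrite [rsubmx _]mx11_scalar => E; exists a, b, d; eexists; apply: E.
Qed.

Lemma vec4_inj a b d e a' b' d' e' : vec4 a b d e = vec4 a' b' d' e' ->
  [/\ a = a', b = b', d = d' & e = e'].
Proof.
rewrite /vec4 => E; have [E1 E2] := @eq_row_mx _ _ 3 1 _ _ _ _ E.
by case/rv3_inj: E1 => -> -> ->; rewrite (scalar_mx1_inj E2).
Qed.

Lemma vec4_0 : 0 = vec4 0 0 0 0.
Proof. by rewrite /vec4 -rv3_0 scalar_mx0 row_mx0. Qed.

Lemma vec4Z x a b d e : x *: vec4 a b d e = vec4 (x * a) (x * b) (x * d) (x * e).
Proof. by rewrite [LHS](@scale_row_mx _ 1 3 1) rv3Z scale_scalar_mx. Qed.

Lemma vec4D a b d e a' b' d' e' :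
  vec4 a b d e + vec4 a' b' d' e' = vec4 (a + a') (b + b') (d + d') (e + e').
Proof.
rewrite [LHS](@add_row_mx _ 1 3 1); apply: (congr2 (@row_mx F 1 3 1)).
  by apply/rowP=> -[[|[|[|//]]] i3]; rewrite !mxE.
by apply/matrixP=> i j; rewrite !mxE mulrnDl.
Qed.

Lemma form4E a b d e a' b' d' e' : vec4 a b d e *m adj (vec4 a' b' d' e') =
  (a * theta a' + b * theta b' + d * theta d' + e * theta e')%:M.
Proof.
have -> : adj (vec4 a' b' d' e') = col_mx (adj (rv3 a' b' d')) (theta e')%:M.
  by rewrite [LHS](@adj_row _ _ 1 3 1) adj_scalar.
rewrite [LHS](@mul_row_col _ 1 3 1 1) form3E -scalar_mxM.
by apply/matrixP=> i j; rewrite !mxE -mulrnDl.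
Qed.

(* (E4, F4) and (E4', F4') span two orthogonal hyperbolic planes; the base flag is
   the point <E4> on the totally isotropic line <E4, E4'>. *)
Definition E4 := vec4 1 c 0 0.
Definition E4' := vec4 0 0 1 c.
Definition F4 := vec4 1 (- c) 0 0.
Definition F4' := vec4 0 0 1 (- c).

Definition col2 n (u v : 'rV[F]_n) : 'M[F]_(2, n) := col_mx u v.

Lemma col2M n m (u v : 'rV[F]_n) (A : 'M_(n, m)) : col2 u v *m A = col2 (u *m A) (v *m A).
Proof. exact: (@mul_col_mx _ 1 1). Qed.

Lemma col2_sub n m (u v : 'rV[F]_n) (A : 'M_(m, n)) :
  (col2 u v <= A)%MS = (u <= A)%MS && (v <= A)%MS.
Proof. exact: (col_mx_sub u v A). Qed.

Lemma form_col2 n (u v u' v' : 'rV[F]_n) : col2 u v *m adj (col2 u' v') =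
  block_mx (u *m adj u') (u *m adj v') (v *m adj u') (v *m adj v') :> 'M_(1 + 1).
Proof.
have -> : adj (col2 u' v') = row_mx (adj u') (adj v') by apply: (@adj_col _ _ 1 1).
exact: (@mul_col_row _ 1 1 n 1 1).
Qed.

Lemma mul_row2 n (x : 'rV[F]_2) (u v : 'rV[F]_n) :
  x *m col2 u v = x 0 0 *: u + x 0 1 *: v.
Proof.
have E (i k : 'I_(1 + 1)) j : val i = val k -> col_mx u v i j = col_mx u v k j.
  by move=> ik; rewrite (val_inj ik).
apply/rowP=> j; rewrite !mxE !big_ord_recl big_ord0 addr0; congr (x 0 _ * _ + x 0 _ * _).
- exact: etrans (E ord0 (lshift 1 0) j erefl) (col_mxEu u v 0 j).
- exact: val_inj.
- exact: etrans (E (lift ord0 ord0) (rshift 1 0) j erefl) (col_mxEd u v 0 j).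
Qed.

Definition L0 := col2 E4 E4'.
Definition L1 := col2 F4 F4'.

Lemma subL0 v : (v <= L0)%MS -> exists x y, v = x *: E4 + y *: E4'.
Proof.
by case/submxP=> D ->; exists (D 0 0), (D 0 1); apply: mul_row2.
Qed.

Lemma subL0E a b d e : (vec4 a b d e <= L0)%MS -> b = a * c /\ e = d * c.
Proof.
case/subL0=> x [y]; rewrite !vec4Z vec4D => /vec4_inj[-> -> -> ->].
by rewrite !mulr0 !addr0 !add0r !mulr1.
Qed.

Lemma E4_L0 : (E4 <= L0)%MS.
Proof.
by have := submx_refl L0; rewrite {1}/L0 col2_sub => /andP[].
Qed.

Lemma E4'_L0 : (E4' <= L0)%MS.
Proof.
by have := submx_refl L0; rewrite {1}/L0 col2_sub => /andP[].
Qed.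

Lemma L0_iso : L0 *m adj L0 = 0.
Proof.
rewrite /L0 form_col2 !form4E !rmorph0 !rmorph1 !mulr0 !addr0 !mulr1 !add0r !mul0r.
by rewrite cE !addrN scalar_mx0 [LHS]block_mx0.
Qed.

Lemma rank_L0 : \rank L0 = 2.
Proof.
apply/eqP/inj_row_free => x; rewrite /L0 mul_row2 !vec4Z vec4D.
rewrite vec4_0 !mulr0 !mulr1 !addr0 !add0r => /vec4_inj[x0 _ x1 _].
by rewrite (rv2P x) x0 x1; apply/rowP=> -[[|[|//]] i2]; rewrite !mxE.
Qed.

Definition blk31 (A : 'M[F]_3) (a : F) : 'M[F]_4 := block_mx A 0 0 (a%:M : 'M_1).

Lemma blk31M A a B b : blk31 A a *m blk31 B b = blk31 (A *m B) (a * b).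
Proof.
apply: etrans (@mulmx_block F 3 1 3 1 3 1 _ _ _ _ _ _ _ _) _.
by rewrite !(mul0mx, mulmx0, addr0, add0r) -scalar_mxM.
Qed.

Lemma blk31_adj A a : adj (blk31 A a) = blk31 (adj A) (theta a).
Proof.
apply: etrans (@adj_block F theta 3 1 3 1 _ _ _ _) _.
by rewrite !adj0 adj_scalar.
Qed.

Lemma blk31_det A a : \det (blk31 A a) = \det A * a.
Proof. by apply: etrans (@det_ublock F 3 1 _ _ _) _; rewrite det_scalar1. Qed.

Lemma blk31_1 : blk31 1%:M 1 = 1%:M.
Proof. exact: esym (@scalar_mx_block F 3 1 1). Qed.

Lemma blk31_inj A a B b : blk31 A a = blk31 B b -> A = B.
Proof. by move=> E; have [-> _ _ _] := @eq_block_mx F 3 1 3 1 _ _ _ _ _ _ _ _ E. Qed.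

(* [psi] maps GU_3(q) onto the stabiliser in SU_4(q) of the last basis point. *)
Definition psi (g : {'GL_3[F]}) : {'GL_4[F]} := GL_mk (blk31 (gmx g) (\det (gmx g))^-1).

Lemma psiE g : gmx (psi g) = blk31 (gmx g) (\det (gmx g))^-1.
Proof.
apply: gmx_GL_mk; have := gmx_unit g; rewrite !unitmxE unitfE => d0.
by rewrite blk31_det mulfV ?unitr1.
Qed.

Lemma psiM : {in GU3 &, {morph psi : g h / (g * h)%g}}.
Proof.
move=> g h _ _; apply: gmx_inj.
by rewrite gmxM !psiE gmxM det_mulmx invfM blk31M.
Qed.
Canonical psi_morphism := Morphism psiM.

Lemma injm_psi : ('injm psi)%g.
Proof.
apply/injmP=> g h _ _ /(congr1 (@gmx _ _)); rewrite !psiE => /blk31_inj.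
exact: gmx_inj.
Qed.

Lemma psi_SU : (psi @* GU3)%g \subset SU.
Proof.
apply/subsetP=> _ /morphimP[g _ Gg ->]; move: Gg; rewrite !inE psiE => /eqP Gg.
have dd := unitary_det Gg.
have d0 : \det (gmx g) != 0 by apply/eqP=> d0; move/eqP: dd; rewrite d0 mul0r eq_sym oner_eq0.
rewrite blk31_det mulfV // eqxx andbT blk31_adj blk31M Gg.
by rewrite fmorphV -invfM dd invr1 blk31_1.
Qed.

Lemma vec4_psi a b d e g : vec4 a b d e *m gmx (psi g) =
  row_mx (rv3 a b d *m gmx g) ((e / \det (gmx g))%:M : 'M_1).
Proof.
rewrite psiE; apply: etrans (@mul_row_block F 1 3 1 3 1 _ _ _ _ _ _) _.
by rewrite !mulmx0 addr0 add0r -scalar_mxM.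
Qed.

(** Scaling the frame of the hyperbolic pair by lam, 1, (theta lam)^-1 keeps its Gram matrix. The
    inverse determinant is the factor by which [psi be] acts on the last coordinate. *)
Lemma homology lam : lam != 0 -> exists2 be, be \in GU3 &
  [/\ pt_e *m gmx be = lam *: pt_e, rv3 0 0 1 *m gmx be = rv3 0 0 1,
      pt_f *m gmx be = (theta lam)^-1 *: pt_f & (\det (gmx be))^-1 = theta lam / lam].
Proof.
move=> l0; have tl0 : theta lam != 0 by rewrite fmorph_eq0.
pose R0 := mx3 pt_e (rv3 0 0 1) pt_f; pose D := diag_mx (rv3 lam 1 (theta lam)^-1).
pose R := D *m R0; have GR0 : R0 *m adj R0 = gramJ F := std_frame_gram thetaE cardF cE.
have GR : R *m adj R = gramJ F.
  rewrite /R adjM -mulmxA [R0 *m _]mulmxA GR0.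
  have -> : adj D = diag_mx (rv3 (theta lam) 1 lam^-1).
    apply/matrixP=> i j; rewrite adjE !mxE.
    by case: i => -[|[|[|//]]] i3; case: j => -[|[|[|//]]] j3;
      rewrite /= ?(mulr1n, mulr0n, rmorph0, rmorph1) // fmorphV tK.
  apply/matrixP=> i j; rewrite mul_diag_mx mxE mul_mx_diag !mxE.
  case: i => -[|[|[|//]]] i3; case: j => -[|[|[|//]]] j3;
    rewrite /= ?(mul0r, mulr0, mul1r, mulr1) //; first by rewrite mulrCA mulfV ?mulr1.
  by rewrite mulrCA mulVf ?mulr1.
have [uR0 uR UR] := frame_unitary (gramJ_unit two0) GR0 GR.
have ube : invmx R0 *m R \in unitmx by rewrite unitmx_mul unitmx_inv uR0.
have [be beE] := GL_exists ube.
have rowR i : row i R0 *m gmx be = row i R by rewrite beE !rowE -mulmxA mulKVmx.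
have rowD i : row i R = (rv3 lam 1 (theta lam)^-1) 0 i *: row i R0.
  by rewrite /R row_mul row_diag_mx -scalemxAl -rowE.
exists be; first by rewrite inE beE UR.
split.
- by have := rowR 0; rewrite rowD !rowK mxE.
- by have := rowR 1; rewrite rowD !rowK mxE /= scale1r.
- by have := rowR ord_max; rewrite rowD !rowK mxE.
- rewrite beE det_mulmx det_inv /R det_mulmx mulrCA mulVf ?mulr1; last first.
    by move: uR0; rewrite unitmxE unitfE.
  rewrite det_diag !big_ord_recl big_ord0 !mxE /= mul1r mulr1 invfM invrK.
  by rewrite mulrC.
Qed.

Lemma E4_powers (be : {'GL_3[F]}) lam m : pt_e *m gmx be = lam *: pt_e ->
  E4 *m gmx (psi be ^+ m)%g = lam ^+ m *: E4.
Proof.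
move=> be_e; elim: m => [|m IHm]; first by rewrite expg0 gmx1 mulmx1 expr0 scale1r.
rewrite expgSr gmxM mulmxA IHm -scalemxAl vec4_psi mul0r be_e rv3Z !mulr1 mulr0.
by rewrite -[row_mx _ _]/(vec4 lam (lam * c) 0 0) !vec4Z !mulr0 mulr1 exprSr mulrA.
Qed.

Lemma E4'_powers (be : {'GL_3[F]}) dl m : rv3 0 0 1 *m gmx be = rv3 0 0 1 ->
  (\det (gmx be))^-1 = dl -> E4' *m gmx (psi be ^+ m)%g = vec4 0 0 1 (c * dl ^+ m).
Proof.
move=> be_3 be_d; elim: m => [|m IHm]; first by rewrite expg0 gmx1 mulmx1 expr0 mulr1.
by rewrite expgSr gmxM mulmxA IHm vec4_psi be_3 be_d -mulrA -exprSr.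
Qed.

(** A totally isotropic line through [E4] is spanned by [E4] and some (0, 0, 1, ga) with ga of norm
    -1. Then ga / c has norm 1, hence is a power of theta lam / lam. *)
Lemma line_through_E4 (be : {'GL_3[F]}) lam g : lam != 0 ->
  (q + 1).-primitive_root (theta lam / lam) -> be \in GU3 ->
  pt_e *m gmx be = lam *: pt_e -> rv3 0 0 1 *m gmx be = rv3 0 0 1 ->
  (\det (gmx be))^-1 = theta lam / lam ->
  g \in SU -> (E4 <= L0 *m gmx g)%MS ->
  exists2 j, (j < q + 1)%N & (L0 *m gmx g <= L0 *m gmx (psi be ^+ j)%g)%MS.
Proof.
move=> l0 pd Gbe be_e be_3 be_d Sg Eg; set L := L0 *m gmx g; set dl := theta lam / lam in pd be_d.
have LL : L *m adj L = 0 by rewrite /L GU_form ?L0_iso // SU_sub_GU.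
have rkL : \rank L = 2 by rewrite /L mxrankMfree ?rank_L0 // row_free_unit gmx_unit.
have [i nEi] : exists i, ~~ (row i L <= E4)%MS.
  apply/row_subPn; apply/negP=> /mxrankS; rewrite rkL.
  by rewrite leqNgt ltnS rank_leq_row.
have isoL (u v : 'rV_4) : (u <= L)%MS -> (v <= L)%MS -> u *m adj v = 0.
  by move=> /submxP[D ->] /submxP[D' ->]; rewrite adjM -mulmxA [L *m _]mulmxA LL mul0mx mulmx0.
have Li := row_sub i L; have [y0 [y1 [y2 [y4 Ey]]]] := vec4P (row i L).
have tc : theta c = - c^-1.
  by apply: (mulfI c0); rewrite cE mulrN mulfV ?c0.
(* By orthogonality to [E4]; subtracting a multiple of [E4] then leaves only the last two
   coordinates. *)
have Ey1 : y1 = y0 * c.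
  have := isoL _ _ Li Eg; rewrite Ey form4E rmorph1 !rmorph0 tc !mulr0 !addr0 mulr1.
  rewrite -(scalar_mx0 _ 1) => /scalar_mx1_inj/eqP.
  by rewrite mulrN subr_eq0 => /eqP->; rewrite divfK ?c0.
have Ez : row i L - y0 *: E4 = vec4 0 0 y2 y4.
  by rewrite Ey Ey1 -scaleNr vec4Z vec4D; congr vec4; ring.
have Lz : (vec4 0 0 y2 y4 <= L)%MS by rewrite -Ez -scaleNr addmx_sub // scalemx_sub.
have N := isoL _ _ Lz Lz; move: N.
rewrite form4E !mul0r !add0r -(scalar_mx0 _ 1) => /scalar_mx1_inj N.
have y20 : y2 != 0.
  apply: contra nEi => /eqP y20; move/eqP: N; rewrite y20 mul0r add0r mulf_eq0 fmorph_eq0 orbb.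
  move/eqP=> y40; have -> : row i L = y0 *: E4.
    apply/eqP; rewrite -subr_eq0 Ez y20 y40; apply/eqP.
    by rewrite -vec4_0.
  exact: scalemx_sub.
pose ga := y4 / y2; have gN : ga * theta ga = -1.
  rewrite /ga fmorph_div mulrACA -invfM; apply/eqP.
  rewrite -subr_eq0 opprK -(mulfV (mulf_neq0 y20 (_ : theta y2 != 0))) ?fmorph_eq0 //.
  by rewrite -mulrDl addrC N mul0r.
have [j jq] : exists2 j, (j < q + 1)%N & ga = c * dl ^+ j.
  have : (ga / c) ^+ (q + 1) = 1.
    apply: (theta_unit_norm1 thetaE); rewrite fmorph_div mulrACA gN -invfM cE.
    by rewrite invrN1 mulrNN mulr1.
  by case/(prim_rootP pd) => j Ej; exists j => //; rewrite -Ej mulrC divfK ?c0.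
move=> gaE; exists j => //.
have sub : (L0 *m gmx (psi be ^+ j)%g <= L)%MS.
  rewrite /L0 col2M col2_sub (E4_powers j be_e) (E4'_powers j be_3 be_d) scalemx_sub //=.
  have -> : vec4 0 0 1 (c * dl ^+ j) = y2^-1 *: vec4 0 0 y2 y4.
    by rewrite vec4Z !mulr0 mulVf // -gaE /ga mulrC.
  by rewrite scalemx_sub.
rewrite -(geq_leqif (mxrank_leqif_sup sub)) rkL mxrankMfree ?rank_L0 //.
by rewrite row_free_unit gmx_unit.
Qed.

End SU4Lines.

(** * Transitivity on totally isotropic lines *)

Section SU4Tiling.

Variables (F : finFieldType) (q : nat) (theta : {rmorphism F -> F}).
Hypotheses (thetaE : forall x, theta x = x ^+ q) (oddq : odd q).
Hypotheses (q_gt2 : (2 < q)%N) (cardF : #|F| = (q ^ 2)%N) (two0 : 2%:R != 0 :> F).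
Variable c : F.
Hypothesis cE : c * theta c = -1.
Local Notation adj := (adj theta).
Local Notation tK := (thetaK thetaE cardF).
Local Notation pt_e := (pt_e c).
Local Notation pt_f := (pt_f c).
Local Notation GU3 := (GU_group theta 2).
Local Notation c0 := (c_neq0 cE).
Local Notation SU := (SU theta).
Local Notation E4 := (E4 c).
Local Notation E4' := (E4' c).
Local Notation L0 := (L0 c).
Local Notation L1 := (L1 c).
Local Notation psi := (psi_morphism theta).

Definition line_stab := stabmx_group SU L0.
Definition flag_stab := stabmx_group line_stab E4.

Lemma E4_psi g : E4 *m gmx (psi g) = row_mx (pt_e *m gmx g) (0 : 'M_1).
Proof. by rewrite vec4_psi mul0r scalar_mx0. Qed.

(** The line meets the hyperplane where the last coordinate is 0 in a nonzero isotropic vector, and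
    GU_3(q) is transitive on the isotropic points there. *)
Lemma SU_line_transitive g : g \in SU ->
  exists2 m, m \in GU3 & (E4 <= L0 *m gmx g *m gmx (psi m)^-1)%MS.
Proof.
move=> Sg; set L := L0 *m gmx g.
have [v [v0 vL [a [b [d Ev]]]]] : exists v : 'rV_4,
    [/\ v != 0, (v <= L)%MS & exists a b d, v = vec4 a b d 0].
  have [a [b [d [e E1]]]] := vec4P (E4 *m gmx g).
  have [a' [b' [d' [e' E2]]]] := vec4P (E4' *m gmx g).
  have LE x : x *m L = x 0 0 *: (E4 *m gmx g) + x 0 1 *: (E4' *m gmx g).
    by rewrite /L mulmxA mul_row2 mulmxDl -!scalemxAl.
  have nz (x : 'rV_2) : x != 0 -> x *m L != 0.
    move=> x0; rewrite /L mulmxA mulmx_gmx_neq0 // -(mul0mx 1 L0).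
    by rewrite (inj_eq (row_free_inj _)) // -row_leq_rank rank_L0.
  have [x [x0 xe]] : exists x : 'rV[F]_2, x != 0 /\ x 0 0 * e + x 0 1 * e' = 0.
    have [-> |e0] := eqVneq e 0.
      exists (rv2 1 0); split; last by rewrite !mxE mulr0 mul0r addr0.
      by apply/eqP=> /rowP/(_ 0)/eqP; rewrite !mxE oner_eq0.
    exists (rv2 e' (- e)); split; last by rewrite !mxE /=; ring.
    by apply/eqP=> /rowP/(_ 1)/eqP; rewrite !mxE oppr_eq0 (negPf e0).
  exists (x *m L); split; [exact: nz | exact: submxMl | ].
  by rewrite LE E1 E2 !vec4Z vec4D xe; eexists; eexists; eexists.
have vv : v *m adj v = 0.
  case/submxP: vL => D ->; rewrite adjM -mulmxA [L *m _]mulmxA /L.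
  by rewrite GU_form ?SU_sub_GU // L0_iso // mul0mx mulmx0.
have u0 : rv3 a b d != 0.
  by apply: contraNneq v0 => E; rewrite Ev /vec4 E scalar_mx0 row_mx0.
have uu : rv3 a b d *m adj (rv3 a b d) = 0.
  by rewrite form3E; move: vv; rewrite Ev form4E mul0r addr0.
have [m Gm /sub_rVP[k Ek]] := trans_iso thetaE cardF two0 cE u0 uu.
exists m => //; have : (E4 *m gmx (psi m) <= L)%MS.
  rewrite E4_psi Ek rv3Z -(scalar_mx0 _ 1) -[row_mx _ _]/(vec4 (k * a) (k * b) (k * d) 0).
  by rewrite -[X in vec4 _ _ _ X](mulr0 k) -vec4Z -Ev scalemx_sub.
by move/(submxMr (gmx (psi m)^-1)); rewrite mulmx_gmxV.
Qed.

Lemma SU_tiling_lines t : tiling GU3 (stabmx GU3 pt_e) t ->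
  exists s, tiling SU line_stab s.
Proof.
move=> tG; have [lam [l0 pd _]] := torus_parameter thetaE q_gt2 cardF.
have [be Gbe [be_e be_3 _ be_d]] := homology thetaE cardF two0 cE l0.
pose b := psi be; pose N1 := (psi @* GU3)%G.
pose Nx := (psi @* stabmx_group GU3 pt_e)%G.
have t1 : tiling N1 Nx [seq ((psi @* x.1)%g, x.2) | x <- t].
  apply: tiling_morphim => //; first exact: stabmx_sub.
  by apply: subset_trans (subsetIr _ _) _; rewrite (trivgP (injm_psi theta)) sub1G.
have sNx : Nx \subset N1 by apply/morphimS/stabmx_sub.
have sN1 : N1 \subset SU by apply: psi_SU.
have Nb : b \in Nx.
  by apply: mem_morphim => //; rewrite inE Gbe andTb be_e scalemx_sub.
have Sb : b \in SU := subsetP sN1 _ (subsetP sNx _ Nb).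
have E4N g : g \in Nx -> (E4 *m gmx g <= E4)%MS.
  case/morphimP=> x Gx; rewrite inE => /andP[_ /sub_rVP[k Ek]] ->.
  rewrite E4_psi Ek rv3Z -(scalar_mx0 _ 1) -[row_mx _ _]/(vec4 (k * 1) (k * c) (k * 0) 0).
  by apply/sub_rVP; exists k; rewrite vec4Z !mulr0.
have line g : g \in SU -> (E4 <= L0 *m gmx g)%MS ->
    exists2 j, (j < q + 1)%N & (g * b ^- j)%g \in line_stab.
  move=> Sg Eg; have [j jq le] := line_through_E4 thetaE cE l0 pd Gbe be_e be_3 be_d Sg Eg.
  have Sgb : (g * b ^- j)%g \in SU by rewrite groupM // groupV groupX.
  exists j => //; rewrite inE Sgb andTb.
  by rewrite gmxM mulmxA; have := submxMr (gmx (b ^- j)%g) le; rewrite mulmx_gmxV.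
have E4g g : (E4 *m gmx g <= E4)%MS -> (E4 <= L0 *m gmx g)%MS.
  move=> le; apply: submx_trans (submxMr _ (E4_L0 c)).
  rewrite -(geq_leqif (mxrank_leqif_sup le)) mxrankMfree //.
  by rewrite row_free_unit gmx_unit.
have [t2 T2] : exists s, tiling Nx (Nx :&: line_stab)%G s.
  apply: (tiling_powers (a := b) (n := (q + 1)%N)) => //; first by rewrite addn1.
  - exact: subsetIl.
  (* The image (0, 0, 1, c dl^j) of [E4'], with dl = theta lam / lam, lies on [L0] only if dl^j =
     1. *)
  - move=> j /andP[j0 jq]; apply/negP=> /setIP[_]; rewrite inE => /andP[_ le].
    have := submx_trans (submxMr (gmx (b ^+ j)%g) (E4'_L0 c)) le.
    rewrite (E4'_powers c j be_3 be_d) => /subL0E[_]; rewrite mul1r -[RHS]mulr1.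
    move/(mulfI c0)/eqP; rewrite -(prim_order_dvd pd) => /(dvdn_leq j0).
    by rewrite leqNgt jq.
  - move=> g Ng; have Sg : g \in SU := subsetP sN1 _ (subsetP sNx _ Ng).
    have [j jq Pj] := line g Sg (E4g g (E4N g Ng)).
    by exists j => //; rewrite inE Pj andbT groupM ?groupV ?groupX.
(* [L0] meets the 3-space in the point of [E4] only, so an element of [N1] that preserves [L0] fixes
   this point. *)
have eqI : Nx :&: line_stab = N1 :&: line_stab.
  apply/eqP; rewrite eqEsubset setSI //=; apply/subsetP=> g /setIP[N1g Pg].
  rewrite inE Pg andbT; case/morphimP: N1g Pg => x _ Gx ->; rewrite inE => /andP[_ le].
  apply: mem_morphim => //; rewrite inE Gx andTb.
  have := submx_trans (submxMr _ (E4_L0 c)) le; rewrite E4_psi.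
  have [a [y [d Ev]]] := rv3P (pt_e *m gmx x); rewrite Ev -(scalar_mx0 _ 1).
  rewrite -[row_mx _ _]/(vec4 a y d 0) => /subL0E[Ey /esym/eqP].
  rewrite mulf_eq0 (negPf c0) orbF => /eqP->; rewrite Ey.
  by apply/sub_rVP; exists a; rewrite rv3Z mulr1 mulr0.
have T3 := tiling_trans sNx t1 T2; rewrite /= eqI in T3.
eexists; apply: tiling_setI T3 => //; first exact: stabmx_sub.
apply/subsetP=> g Sg; have [m Gm Em] := SU_line_transitive Sg.
have Nm : psi m \in N1 by apply: mem_morphim.
have Sgm : (g * (psi m)^-1)%g \in SU by rewrite groupM // groupV (subsetP sN1).
have [|j _ Pj] := line _ Sgm; first by rewrite gmxM mulmxA.
apply/mulsgP; exists (g * (psi m)^-1 * b ^- j)%g (b ^+ j * psi m)%g => //.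
  by rewrite groupM // groupX // (subsetP sNx).
by rewrite mulgA mulgKV mulgKV.
Qed.

(** A central element preserves the eigenspaces of [psi be], and by the choice of [lam] that of
    [lam] is spanned by [E4]. *)
Lemma centre_E4 z : z \in ('Z(SU))%g -> (E4 *m gmx z <= E4)%MS.
Proof.
have [lam [l0 pd [l1 ll l2]]] := torus_parameter thetaE q_gt2 cardF.
have [be Gbe [be_e be_3 be_f be_d]] := homology thetaE cardF two0 cE l0.
case/centerP=> Sz Cz; have Sb : psi be \in SU.
  by apply: (subsetP (psi_SU theta)); apply: mem_morphim.
have comm : E4 *m gmx z *m gmx (psi be) = lam *: (E4 *m gmx z).
  have Eb : E4 *m gmx (psi be) = lam *: E4 by have := E4_powers 1 be_e; rewrite expg1 expr1.
  by rewrite scalemxAl -Eb -!mulmxA -!gmxM Cz.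
have [a [b [d [e E]]]] := vec4P (E4 *m gmx z); rewrite E in comm *.
pose x0 := (a + b / c) / 2; pose x2 := (a - b / c) / 2.
have Eu : rv3 a b d = x0 *: pt_e + d *: rv3 0 0 1 + x2 *: pt_f.
  apply/rowP=> -[[|[|[|//]]] i3]; rewrite !mxE /= /x0 /x2; field; rewrite ?two0 ?c0 //.
move: comm; rewrite vec4_psi be_d => comm.
have [E1 E2] := @eq_row_mx _ _ 3 1 _ _ _ _ (etrans comm (vec4Z lam a b d e)).
have {E2}e0 : e = 0.
  have := scalar_mx1_inj E2 => /eqP; rewrite mulrC -subr_eq0 -mulrBl mulf_eq0 => /orP[|/eqP//].
  rewrite subr_eq0 => /eqP El; case/negP: l2; apply/eqP.
  by rewrite -[theta lam](divfK l0) El.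
move: E1; rewrite Eu !mulmxDl -!scalemxAl be_e be_3 be_f -rv3Z Eu !scalerDr !scalerA.
move=> /rowP E1; have E10 := E1 0; have E11 := E1 1; have E12 := E1 ord_max.
move: E10 E11 E12; rewrite !mxE /= => E10 E11 E12.
have d0 : d = 0.
  move: E12; rewrite !mulr0 !addr0 !add0r !mulr1 => /eqP; rewrite -subr_eq0 -{1}[d]mul1r -mulrBl mulf_eq0.
  by rewrite subr_eq0 eq_sym (negPf l1) => /eqP.
have x20 : x2 = 0.
  have E10' : x2 * ((theta lam)^-1 - lam) = 0.
    apply: (mulfI two0); rewrite mulr0; apply: (mulfI c0); rewrite mulr0.
    have : (c * (x0 * lam * 1 + d * 0 + x2 / theta lam * 1) - (x0 * lam * c + d * 0 + x2 / theta lam * - c))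
      = (c * (lam * x0 * 1 + lam * d * 0 + lam * x2 * 1) - (lam * x0 * c + lam * d * 0 + lam * x2 * - c)).
      by rewrite E10 E11.
    by move/eqP; rewrite -subr_eq0 => /eqP <-; ring.
  move/eqP: E10'; rewrite mulf_eq0 => /orP[/eqP//|]; rewrite subr_eq0 => /eqP El.
  by case/negP: ll; rewrite -{1}El mulVf // fmorph_eq0.
rewrite /vec4 Eu d0 x20 !scale0r !addr0 e0 rv3Z mulr0 mulr1.
by apply/sub_rVP; exists x0; rewrite vec4Z mulr1 !mulr0.
Qed.

End SU4Tiling.

(** * The line stabiliser, the flag stabiliser and the quotient by the centre *)

Section SU4Borel.

Variables (F : finFieldType) (p q : nat) (theta : {rmorphism F -> F}).
Hypotheses (thetaE : forall x, theta x = x ^+ q) (oddq : odd q).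
Hypotheses (q_gt2 : (2 < q)%N) (cardF : #|F| = (q ^ 2)%N) (two0 : 2%:R != 0 :> F).
Hypothesis pcharF : p \in [pchar F].
Variable c : F.
Hypothesis cE : c * theta c = -1.
Local Notation adj := (adj theta).
Local Notation tK := (thetaK thetaE cardF).
Local Notation c0 := (c_neq0 cE).
Local Notation SU := (SU theta).
Local Notation E4 := (E4 c).
Local Notation E4' := (E4' c).
Local Notation F4 := (F4 c).
Local Notation F4' := (F4' c).
Local Notation L0 := (L0 c).
Local Notation L1 := (L1 c).
Local Notation line_stab := (line_stab theta c).
Local Notation flag_stab := (flag_stab theta c).

Definition blk22 (A B : 'M[F]_2) : 'M[F]_4 := block_mx A 0 0 B.
Definition anti22 (A B : 'M[F]_2) : 'M[F]_4 := block_mx 0 A B 0.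

Lemma blk22M A B A' B' : blk22 A B *m blk22 A' B' = blk22 (A *m A') (B *m B').
Proof.
apply: etrans (@mulmx_block F 2 2 2 2 2 2 _ _ _ _ _ _ _ _) _.
by rewrite !(mul0mx, mulmx0, addr0, add0r).
Qed.

Lemma blk22_anti A B A' B' : blk22 A B *m anti22 A' B' = anti22 (A *m A') (B *m B').
Proof.
apply: etrans (@mulmx_block F 2 2 2 2 2 2 _ _ _ _ _ _ _ _) _.
by rewrite !(mul0mx, mulmx0, addr0, add0r).
Qed.

Lemma anti_blk22 A B A' B' : anti22 A B *m blk22 A' B' = anti22 (A *m B') (B *m A').
Proof.
apply: etrans (@mulmx_block F 2 2 2 2 2 2 _ _ _ _ _ _ _ _) _.
by rewrite !(mul0mx, mulmx0, addr0, add0r).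
Qed.

Lemma anti22M A B A' B' : anti22 A B *m anti22 A' B' = blk22 (A *m B') (B *m A').
Proof.
apply: etrans (@mulmx_block F 2 2 2 2 2 2 _ _ _ _ _ _ _ _) _.
by rewrite !(mul0mx, mulmx0, addr0, add0r).
Qed.

Lemma blk22_adj A B : adj (blk22 A B) = blk22 (adj A) (adj B).
Proof. by apply: etrans (@adj_block F theta 2 2 2 2 _ _ _ _) _; rewrite !adj0. Qed.

Lemma blk22_det A B : \det (blk22 A B) = \det A * \det B.
Proof. exact: (@det_ublock F 2 2). Qed.

Lemma blk22_1 : blk22 1%:M 1%:M = 1%:M.
Proof. exact: esym (@scalar_mx_block F 2 2 1). Qed.

Definition R4 : 'M[F]_4 := col_mx L0 L1.

Lemma blk22_R4 A B : blk22 A B *m R4 = col_mx (A *m L0) (B *m L1).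
Proof.
apply: etrans (@mul_block_col F 2 2 2 2 4 _ _ _ _ _ _) _.
by rewrite !mul0mx addr0 add0r.
Qed.

Lemma R4_inj A B A' B' : col_mx A B = col_mx A' B' :> 'M[F]_(2 + 2, 4) -> A = A' /\ B = B'.
Proof. by move/eq_col_mx. Qed.

Lemma R4_gram : R4 *m adj R4 = anti22 2%:M 2%:M.
Proof.
have -> : adj R4 = row_mx (adj L0) (adj L1) by apply: (@adj_col F theta 2 2).
apply: etrans (@mul_col_row F 2 2 4 2 2 _ _ _ _) _.
have L01 : L0 *m adj L1 = 2%:M.
  rewrite form_col2 !form4E !rmorphN !rmorph0 !rmorph1 !mulrN cE !opprK.
  rewrite !(mulr0, mul0r, mulr1, oppr0, addr0, add0r) scalar_mx0.
  by rewrite [RHS](@scalar_mx_block F 1 1 2).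
have L11 : L1 *m adj L1 = 0.
  rewrite form_col2 !form4E !rmorphN !rmorph0 !rmorph1 !mulrNN cE.
  rewrite !(mulr0, mul0r, mulr1, oppr0, addr0, add0r) subrr scalar_mx0.
  exact: (@block_mx0 F 1 1 1 1).
have L10 : L1 *m adj L0 = 2%:M.
  by rewrite -[L1](adjK thetaE cardF) -adjM L01 adj_scalar rmorph_nat.
by rewrite (L0_iso cE) L01 L11 L10.
Qed.

Lemma anti22_unit : anti22 2%:M 2%:M \in unitmx.
Proof.
have : anti22 2%:M 2%:M *m anti22 2%:R^-1%:M 2%:R^-1%:M = 1%:M.
  by rewrite anti22M -!scalar_mxM mulfV // blk22_1.
by case/mulmx1_unit.
Qed.

Lemma R4_unit : R4 \in unitmx.
Proof. by have := anti22_unit; rewrite -R4_gram unitmx_mul => /andP[]. Qed.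

(* An element of SL_2 acts on the line <E4, E4'>, and dually on <F4, F4'>. *)
Definition levi_mx (S : 'M[F]_2) : 'M[F]_4 := invmx R4 *m (blk22 S (invmx (adj S)) *m R4).
Definition levi (g : {'GL_2[F]}) : {'GL_4[F]} := GL_mk (levi_mx (gmx g)).

Lemma adj_unit n (S : 'M[F]_n) : (adj S \in unitmx) = (S \in unitmx).
Proof. by rewrite /adj unitmx_tr map_unitmx. Qed.

(** The factor on [L1] is the conjugate inverse of that on [L0], so the products between the two
    lines do not change and the moved frame keeps its Gram matrix. *)
Lemma levi_unitary (S : 'M[F]_2) : S \in unitmx ->
  levi_mx S *m adj (levi_mx S) = 1%:M.
Proof.
move=> uS; have uS' : adj S \in unitmx by rewrite adj_unit.
have SS : S *m adj (invmx (adj S)) = 1%:M.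
  by rewrite -{1}[S](adjK thetaE cardF) -adjM mulVmx // adj1.
have G : (blk22 S (invmx (adj S)) *m R4) *m adj (blk22 S (invmx (adj S)) *m R4) = anti22 2%:M 2%:M.
  rewrite adjM -mulmxA [R4 *m _]mulmxA R4_gram blk22_adj anti_blk22 blk22_anti.
  by rewrite !mul_scalar_mx -!scalemxAr SS mulVmx // scalemx1.
by have [_ _] := frame_unitary anti22_unit R4_gram G.
Qed.

Lemma leviE g : gmx (levi g) = levi_mx (gmx g).
Proof. by apply/gmx_GL_mk/unitary_unit/levi_unitary/gmx_unit. Qed.

Lemma leviM : {in SL2 F &, {morph levi : g h / (g * h)%g}}.
Proof.
move=> g h _ _; apply: gmx_inj; rewrite gmxM !leviE gmxM /levi_mx.
have ug : adj (gmx g) \in unitmx by rewrite adj_unit gmx_unit.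
have uh : adj (gmx h) \in unitmx by rewrite adj_unit gmx_unit.
have -> : invmx (adj (gmx g *m gmx h)) = invmx (adj (gmx g)) *m invmx (adj (gmx h)).
  have uA : adj (gmx h) *m adj (gmx g) \in unitmx by rewrite unitmx_mul uh.
  have E : (adj (gmx h) *m adj (gmx g)) *m (invmx (adj (gmx g)) *m invmx (adj (gmx h))) = 1%:M.
    by rewrite mulmxA -(mulmxA (adj (gmx h))) mulmxV // mulmx1 mulmxV.
  by rewrite adjM -[RHS](mulKmx uA) E mulmx1.
by rewrite -blk22M -!mulmxA mulKVmx ?R4_unit.
Qed.
Canonical levi_morphism := Morphism leviM.

Lemma L0_levi g : L0 *m gmx (levi g) = gmx g *m L0.
Proof.
have : R4 *m gmx (levi g) = blk22 (gmx g) (invmx (adj (gmx g))) *m R4.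
  by rewrite leviE /levi_mx mulKVmx ?R4_unit.
rewrite blk22_R4 => E; have E' := etrans (esym (@mul_col_mx F 2 2 4 4 L0 L1 _)) E.
by have [] := R4_inj E'.
Qed.

Lemma L0_free : row_free L0.
Proof. by rewrite -row_leq_rank rank_L0. Qed.

Lemma E4_line2 : E4 = line2 F *m L0.
Proof. by rewrite /L0 mul_row2 !mxE /= scale1r scale0r addr0. Qed.

Lemma E4_levi g : E4 *m gmx (levi g) = line2 F *m gmx g *m L0.
Proof. by rewrite {1}E4_line2 -mulmxA L0_levi mulmxA. Qed.

Lemma injm_levi : ('injm levi)%g.
Proof.
apply/injmP=> g h _ _ E; apply: gmx_inj; apply: (row_free_inj L0_free).
by rewrite -!L0_levi E.
Qed.

Lemma levi_sub : (levi @* SL2 F)%g \subset line_stab.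
Proof.
apply/subsetP=> _ /morphimP[g _ Gg ->]; rewrite inE L0_levi submxMl andbT.
rewrite inE; apply/andP; split; first by rewrite inE leviE levi_unitary ?gmx_unit.
have ug := gmx_unit g; have ug' : adj (gmx g) \in unitmx by rewrite adj_unit.
move: Gg; rewrite inE => /eqP Gg.
rewrite leviE /levi_mx !det_mulmx det_inv blk22_det det_inv det_adj Gg rmorph1 invr1 !mul1r.
by rewrite mulVf //; have := R4_unit; rewrite unitmxE unitfE.
Qed.

Lemma E4_neq0 : E4 != 0.
Proof. by apply/eqP; rewrite vec4_0 => /vec4_inj[/eqP]; rewrite oner_eq0. Qed.

Lemma flag_tiling : exists s, tiling line_stab flag_stab s.
Proof.
have [n [nonsq sq]] := nonsquare_exists oddq q_gt2 cardF two0.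
have [t T] := SL2_tiling nonsq sq two0.
pose N := (levi @* SL2 F)%G.
have T1 : tiling N (levi @* stabmx (SL2 F) (line2 F))%g
    [seq ((levi @* x.1)%g, x.2) | x <- t].
  apply: (tiling_morphim (H := stabmx_group (SL2 F) (line2 F))) T => //; first exact: stabmx_sub.
  by apply: subset_trans (subsetIr _ _) _; rewrite (trivgP injm_levi) sub1G.
have eqI : (levi @* stabmx (SL2 F) (line2 F))%g = N :&: flag_stab.
  apply/setP=> x; apply/morphimP/setIP => [[g Sg]|[/morphimP[g Sg Gg ->]]].
    rewrite inE => /andP[Gg le] ->; split; first exact: mem_morphim.
    rewrite inE (subsetP levi_sub) ?mem_morphim // E4_levi E4_line2.
    exact: submxMr.
  rewrite inE => /andP[_]; rewrite E4_levi E4_line2 submxMfree ?L0_free // => le.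
  by exists g => //; rewrite inE Gg le.
rewrite eqI in T1; eexists; apply: tiling_setI T1; [exact: stabmx_sub | | exact: levi_sub].
apply/subsetP=> g Pg; have := Pg; rewrite inE => /andP[_ /submxP[A EA]].
(* Any nonzero row is the first row of a matrix of determinant 1, so SL_2 already moves [E4] to each
   vector of the line. *)
have [S GS ES] : exists2 S, S \in SL2 F & line2 F *m gmx S = line2 F *m A.
  have v0 : line2 F *m A != 0.
    apply/eqP=> v0; have := mulmx_gmx_neq0 g E4_neq0.
    by rewrite E4_line2 -mulmxA EA mulmxA v0 mul0mx eqxx.
  move: v0; rewrite (rv2P (line2 F *m A)); move: (_ 0 0) (_ 0 1) => x y v0.
  have [x0|x0] := eqVneq x 0.
    have y0 : y != 0.
      by apply: contraNneq v0 => y0; rewrite x0 y0; apply/eqP/rowP=> -[[|[|//]] i2]; rewrite !mxE.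
    have [|S GS ES] := @SL2_exists F 0 y (- y^-1) 0; first by rewrite mulr0 sub0r mulrN opprK mulfV.
    by exists S => //; rewrite ES rv2M !mul1r !mul0r !addr0 x0.
  have [|S GS ES] := @SL2_exists F x y 0 x^-1; first by rewrite mulr0 subr0 mulfV.
  by exists S => //; rewrite ES rv2M !mul1r !mul0r !addr0.
have NS : levi S \in N by apply: mem_morphim.
apply/mulsgP; exists (g * (levi S)^-1)%g (levi S) => //; last by rewrite mulgKV.
have PgS : (g * (levi S)^-1)%g \in line_stab.
  have PS : levi S \in line_stab := subsetP levi_sub _ NS.
  exact: (@groupM _ line_stab _ _ Pg (@groupVr _ line_stab _ PS)).
rewrite inE PgS andTb gmxM mulmxA.
have -> : E4 *m gmx g = E4 *m gmx (levi S).
  by rewrite E4_levi ES {1}E4_line2 -mulmxA EA mulmxA.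
by rewrite mulmx_gmxV.
Qed.

(** A central element fixes the point of [E4], hence also its image under a Levi element, the point
    of [E4'], and so the line through both. *)
Lemma centre_flag : ('Z(SU) \subset flag_stab)%g.
Proof.
apply/subsetP=> z Zz; have Ez := centre_E4 thetaE q_gt2 cardF two0 cE Zz.
have /centerP[Sz Cz] := Zz.
have [|S GS ES] := @SL2_exists F 0 1 (-1) 0; first by rewrite mulr0 sub0r mulrN1 opprK.
have SS : levi S \in SU.
  by apply: (subsetP (stabmx_sub SU L0)); apply: (subsetP levi_sub); apply: mem_morphim.
have E' : E4' = E4 *m gmx (levi S).
  rewrite E4_levi ES rv2M !mul1r !mul0r !addr0 mul_row2 !mxE /= scale0r scale1r add0r //.
have Ez' : (E4' *m gmx z <= E4')%MS.
  by rewrite E' -mulmxA -gmxM -(Cz _ SS) gmxM mulmxA submxMr.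
rewrite inE Ez andbT inE Sz andTb {1}/L0 col2M col2_sub.
by rewrite (submx_trans Ez (E4_L0 c)) (submx_trans Ez' (E4'_L0 c)).
Qed.

(* In this order the flag <E4> < <E4, E4'> < E4^perp consists of initial
   segments of the frame, so its stabiliser is lower triangular. *)
Definition flag_frame : 'M[F]_4 := \matrix_i [:: E4; E4'; F4'; F4]`_i.

(** [H] is the inverse Gram matrix of the frame. The resulting inverse of [T] expresses the entries
    of a conjugate by [T] as values of the form. *)
Lemma flag_frame_unit (T := flag_frame) (H : 'M[F]_4 := \matrix_(i, j) ((i + j == 3)%N%:R / 2%:R)) :
  T *m (adj T *m H) = 1%:M.
Proof.
have G : T *m adj T = \matrix_(i, j) ((i + j == 3)%N%:R * 2%:R).
  apply/matrixP=> i j; rewrite -{1}[T]mulmx1 form_entry mulmx1 !rowK [RHS]mxE.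
  case: i => -[|[|[|[|//]]]] i4; case: j => -[|[|[|[|//]]]] j4; rewrite /= form4E mxE eqxx mulr1n;
    rewrite ?rmorphN ?rmorph0 ?rmorph1 ?mulrN ?mulNr ?cE ?opprK;
    rewrite !(mulr0, mul0r, mulr1, mul1r, oppr0, addr0, add0r) ?subrr //.
rewrite mulmxA G; apply/matrixP=> -[[|[|[|[|//]]]] i4] -[[|[|[|[|//]]]] j4];
  rewrite !mxE !big_ord_recl big_ord0 !mxE /= !(mul0r, mulr0, mul1r, addr0, add0r) ?divff //.
Qed.

Lemma flag_solvable : solvable flag_stab.
Proof.
have TH := flag_frame_unit; set T := flag_frame in TH; set H : 'M[F]_4 := \matrix_(i, j) _ in TH.
have [uT _] := mulmx1_unit TH.
have iT : invmx T = adj T *m H by rewrite -[RHS](mulKmx uT) TH mulmx1.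
apply: (trig_solvable pcharF uT) => g; rewrite inE => /andP[].
rewrite inE => /andP[Sg L0g] /sub_rVP[a Ea].
have a0 : a != 0.
  by apply/eqP=> a0; have := mulmx_gmx_neq0 g E4_neq0; rewrite Ea a0 scale0r eqxx.
have [x [y Exy]] := subL0 (submx_trans (submxMr (gmx g) (E4'_L0 c)) L0g).
have e_e : E4 *m adj E4 = 0.
  by rewrite form4E rmorph1 !rmorph0 cE !mulr0 !addr0 mulr1 subrr scalar_mx0.
have e_e' : E4 *m adj E4' = 0.
  by rewrite form4E rmorph1 !rmorph0 !mulr0 !mul0r !addr0 scalar_mx0.
have e_f' : E4 *m adj F4' = 0.
  by rewrite form4E rmorph1 !rmorph0 !mulr0 !mul0r !addr0 scalar_mx0.
have e'_e' : E4' *m adj E4' = 0.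
  by rewrite form4E rmorph1 !rmorph0 cE !mulr0 !add0r mulr1 subrr scalar_mx0.
have e'_e : E4' *m adj E4 = 0 by rewrite -[E4'](adjK thetaE cardF) -adjM e_e' adj0.
have f'_e : F4' *m adj E4 = 0 by rewrite -[F4'](adjK thetaE cardF) -adjM e_f' adj0.
(* [g] scales [E4], so it preserves the orthogonal complement of [E4], which contains [F4']. *)
have f'g_e : F4' *m gmx g *m adj E4 = 0.
  have := GU_form F4' E4 (SU_sub_GU Sg); rewrite f'_e Ea adjZ -scalemxAr => /eqP.
  by rewrite scaler_eq0 fmorph_eq0 (negPf a0) => /eqP.
apply/is_trig_mxP=> i j ij; rewrite iT mulmxA mxE big1 // => l _.
(* Only l = 3 - j contributes: the entry (i, j) is half the product of the i-th frame vector moved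
   by [g] with the l-th one, and i < j means i + l < 3. *)
have [lj|lj] := eqVneq (l + j)%N 3%N; last first.
  by rewrite [H l j]mxE (negPf lj) mul0r mulr0.
rewrite form_entry !rowK; have il : (i + l < 3)%N.
  by apply: (@leq_trans (l + j)); [rewrite addnC ltn_add2l | rewrite lj].
suff -> : [:: E4; E4'; F4'; F4]`_i *m gmx g *m adj [:: E4; E4'; F4'; F4]`_l = 0.
  by rewrite mxE mul0r.
move: i l il {ij lj} => -[[|[|[|[|//]]]] i4] -[[|[|[|[|//]]]] l4] //= _;
  rewrite ?Ea ?Exy ?mulmxDl -?scalemxAl ?(e_e, e_e', e_f', e'_e, e'_e', f'g_e) ?scaler0 ?addr0 //.
Qed.

Lemma PSU4_MLS t : tiling (GU_group theta 2) (stabmx (GU_group theta 2) (pt_e c)) t ->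
  has_MLS (PSU4 F q).
Proof.
move=> tG; have [s1 T1] := SU_tiling_lines thetaE q_gt2 cardF two0 cE tG.
have [s2 T2] := flag_tiling; have sLS : line_stab \subset SU by apply: stabmx_sub.
have T3 := tiling_trans sLS T1 T2.
have defG : SU4 F q = SU :> {set {'GL_4[F]}} by rewrite /= (SUE thetaE) genGid.
have sFS : flag_stab \subset SU4 F q.
  by rewrite defG; apply: subset_trans (stabmx_sub _ _) sLS.
have sZF : ('Z(SU4 F q) \subset flag_stab)%g by rewrite defG centre_flag.
have nZ : (SU4 F q \subset 'N('Z(SU4 F q)))%g by rewrite normal_norm ?center_normal.
have T4 : tiling (SU4 F q) flag_stab (s2 ++ s1) by rewrite defG.
have T5 : tiling (SU4 F q / 'Z(SU4 F q))%g (flag_stab / 'Z(SU4 F q))%g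
    [seq ((x.1 / 'Z(SU4 F q))%g, x.2) | x <- s2 ++ s1].
  apply: (tiling_morphim (f := coset_morphism _)) T4 => //.
  by apply: subset_trans (subsetIr _ _) _; rewrite ker_coset.
have [s6 T6] := tiling_sol (quotient_sol 'Z(SU4 F q) flag_solvable).
have T7 := tiling_trans (quotientS 'Z(SU4 F q) sFS : (flag_stab / _)%G \subset (PSU4 F q)) T5 T6.
exact: tiling1_MLS T7.
Qed.

End SU4Borel.

Local Open Scope nat_scope.

Theorem theorem4p5 (p k q : nat) (F : finFieldType) :
  prime p -> (0 < k)%N -> q = (p ^ k)%N -> odd q -> #|F| = (q ^ 2)%N ->
  (prime (q ^ 2 - q + 1) -> has_MLS (PSU4 F q)) /\
  ((5 < q)%N -> (exists r, prime r /\ q + 1 = 2 * r) -> has_MLS (PSU4 F q)).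
Proof.
move=> p_pr k0 qE oddq cardF.
have pcharF : (p \in [pchar F])%R.
  by apply: (card_finPcharP (n := (k * 2)%N)) => //; rewrite cardF qE -expnM.
have p2 : (2 < p)%N.
  rewrite ltn_neqAle prime_gt1 // andbT; apply: contraTneq oddq => p2.
  by rewrite qE -p2 oddX /= orbF -lt0n.
have q2 : (2 < q)%N by rewrite qE (leq_trans p2) // -{1}[p]expn1 leq_pexp2l // prime_gt0.
have two0 : (2%:R != 0 :> F)%R.
  by rewrite -(dvdn_pcharf pcharF); apply: contraL p2 => /dvdn_leq; rewrite -leqNgt; apply.
have [theta thetaE'] := expn_rmorphism k pcharF.
have thetaE x : theta x = (x ^+ q)%R by rewrite thetaE' -qE.
have [c cE] := norm_exists_neg1 thetaE oddq q2 cardF two0.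
have MLS := PSU4_MLS thetaE oddq q2 cardF two0 pcharF cE.
split=> [pr | _ [r [pr qr]]].
  have [t T] := GU3_tiling_torus thetaE oddq q2 cardF two0 pcharF qE cE pr.
  exact: MLS T.
have [t T] := GU3_tiling_singer thetaE oddq q2 cardF two0 pcharF qE cE pr qr.
exact: MLS T.
Qed.
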